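(* Let $p$ be a prime, let $G$ be a finite $p$-solvable group, and let $B$ be the principal $p$-block of $G$. Suppose that a defect group $D$ of $B$ is non-abelian. Then $mh(B)=mh(D)$.
   Context: For a positive integer $n$, $n_p$ denotes the largest power of $p$ dividing $n$. For a finite group $G$, $\mathrm{Irr}(G)$ is the set of irreducible complex characters of $G$, and for a $p$-block $B$ of $G$, $\mathrm{Irr}(B)\subseteq \mathrm{Irr}(G)$ is the set of irreducible complex characters belonging to $B$. The principal $p$-block is the $p$-block containing the trivial character $1_G$; its defect groups are the Sylow $p$-subgroups of $G$. Heights: let $B$ be a $p$-block of $G$ with defect group $D$, and write $|G|_p=p^a$, $|D|=p^d$. By a theorem of Brauer, the minimum of $\chi(1)_p$ over $\chi\in\mathrm{Irr}(B)$ is $p^{a-d}$, so each $\chi\in\mathrm{Irr}(B)$ satisfies $\chi(1)_p=p^{a-d+h}$ for a unique integer $h=h(\chi)\ge 0$, called the height of $\chi$. When $D$ is non-abelian, some $\chi\in\mathrm{Irr}(B)$ has $h(\chi)>0$ (Brauer's Height Zero Conjecture, now a theorem), and $mh(B)$ denotes the minimum of the non-zero heights of the characters in $\mathrm{Irr}(B)$. For a non-abelian finite $p$-group $D$, $mh(D)$ denotes the same invariant for the unique $p$-block of $D$ (for which $\mathrm{Irr}(B)=\mathrm{Irr}(D)$); that is, $p^{mh(D)}$ is the smallest degree of a non-linear irreducible complex character of $D$. *)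

(* Defs.v *)
From HB Require Import structures.
From mathcomp Require Import all_boot all_order all_algebra all_fingroup.
From mathcomp Require Import all_solvable all_field all_character.

Set Implicit Arguments.
Unset Strict Implicit.
Unset Printing Implicit Defensive.

Import Order.TTheory GRing.Theory Num.Theory.
Local Open Scope group_scope.
Local Open Scope ring_scope.

Section PSolvable.

Variables (gT : finGroupType) (p : nat).

(* The factor U / V of a series of subgroups normalised by A. *)
Definition psolvable_factor (A V U : {set gT}) : bool :=
  invariant_factor A V U && (p.-group (U / V)%g || p^'.-group (U / V)%g).

Definition psolvable (G : {group gT}) : Prop :=
  exists2 s : seq {group gT},
    (psolvable_factor G).-series 1%G s & last 1%G s = G.

End PSolvable.

(* Ideals of the ring Aint of all algebraic integers. *)
Definition Aint_ideal (I : algC -> Prop) : Prop :=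
  [/\ forall x, I x -> x \in Aint,
      I 0,
      forall x y, I x -> I y -> I (x + y)
    & forall a x, a \in Aint -> I x -> I (a * x)].

Definition Aint_maximal_ideal (M : algC -> Prop) : Prop :=
  [/\ Aint_ideal M, ~ M 1
    & forall J : algC -> Prop, Aint_ideal J -> ~ J 1 ->
        (forall x, M x -> J x) -> forall x, J x -> M x].

(* The usual choice on which block theory rests: a maximal ideal M of Aint    *)
(* with p \in M; then Aint / M is an algebraic closure of 'F_p. M is a        *)
(* boolean predicate so that blocks can be finite sets.                       *)
Definition maximal_ideal_over (p : nat) (M : {pred algC}) : Prop :=
  Aint_maximal_ideal (fun x => x \in M) /\ p%:R \in M.

Section Blocks.

Variables (gT : finGroupType) (p : nat) (M : {pred algC}) (G : {group gT}).

(* A block is represented by the set of (indices of) its irreducible ordinary *)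
(* characters. The reductions mod M of the central characters 'omega_i and    *)
(* 'omega_j agree iff they agree on the class sums 'K_k, a basis of the       *)
(* centre of the group algebra.                                               *)
Definition same_block (i j : Iirr G) : bool :=
  [forall k : 'I_#|classes G|, 'omega_i['K_k] - 'omega_j['K_k] \in M].

Definition block_of (i : Iirr G) : {set Iirr G} := [set j | same_block i j].

(* 'chi_0 is the trivial character. *)
Definition principal_block : {set Iirr G} := block_of 0.

(* The coefficient at x of the central idempotent \sum_(i in B) 'e_i; see     *)
(* Wedderburn_id_expansion.                                                   *)
Definition block_id_coef (B : {set Iirr G}) (x : gT) : algC :=
  #|G|%:R^-1 * \sum_(i in B) 'chi_i 1%g * 'chi_i (x^-1)%g.

(* By a theorem of Osima block_id_coef takes its values in the localisation   *)
(* of Aint at M; vanishes_mod M a says that a lies in its maximal ideal.      *)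
Definition vanishes_mod (a : algC) : Prop :=
  exists s : algC, [/\ s \in Aint, s \notin M & s * a \in M].

Definition defect_class (B : {set Iirr G}) (k : 'I_#|classes G|) : Prop :=
  (exists2 i, i \in B & 'omega_i['K_k] \notin M)
  /\ ~ vanishes_mod (block_id_coef B (repr (enum_val k))).

Definition defect_group (B : {set Iirr G}) (D : {group gT}) : Prop :=
  exists k : 'I_#|classes G|, defect_class B k
    /\ exists2 x, x \in enum_val k & p.-Sylow('C_G[x]) D.

End Blocks.

Section Heights.

Variables (gT : finGroupType) (p : nat) (G : {group gT}).

(* Height of 'chi_i as a character of a block with defect group D: the h such *)
(* that 'chi_i(1)_p = p ^ (a - d + h), where #|G|_p = p ^ a, #|D|_p = p ^ d.  *)
(* The subtraction is not truncated, by Brauer's theorem on the minimum of    *)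
(* 'chi_i(1)_p over a block.                                                  *)
Definition height (D : {group gT}) (i : Iirr G) : nat :=
  (logn p (Num.truncn ('chi_i 1%g)) + logn p #|D| - logn p #|G|)%N.

(* The least nonzero height in B, or the junk value 0 if B has none. *)
Definition mh (B : {set Iirr G}) (D : {group gT}) : nat :=
  if [pick i in B | 0 < height D i]%N is Some i0 then
    height D [arg min_(i < i0 | (i \in B) && (0 < height D i)%N) height D i]
  else 0%N.

End Heights.

(* For a p-group D: its unique p-block has Irr(B) = Irr(D) and defect group D *)
Definition mh_pgroup (gT : finGroupType) (p : nat) (D : {group gT}) : nat :=
  mh p [set: Iirr D] D.

(* Main.v *)
From HB Require Import structures.
Require Import Defs.
From mathcomp Require Import all_boot all_order all_algebra all_fingroup.
From mathcomp Require Import all_solvable all_field all_character.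

Set Implicit Arguments.
Unset Strict Implicit.
Unset Printing Implicit Defensive.

Import Order.TTheory GRing.Theory Num.Theory.
Local Open Scope group_scope.
Local Open Scope ring_scope.

(** A defect group of the principal block is a Sylow p-subgroup P of G, so
    heights in the block are exponents of p in character degrees, and the
    irreducible characters in the block are those with 'O_p^'(G) in their kernel
    (mem_principal_block). It remains to compare the nonlinear characters of P with
    the characters of G / 'O_p^'(G) of degree divisible by p, in both directions.

    From P to G (exists_small_deg): if P has a nonlinear character theta, then G has
    an irreducible character of degree divisible by p, with p-part at most
    theta(1). Constituents of the induced character are the natural candidates.
    When they fail, a linear constituent lambda of theta on a normal p-subgroup
    either extends to P and can be divided out, or is fixed by a Sylow subgroup
    other than P. In the second case the characters are produced from the two Sylow
    subgroups (Sylow_pair_deg): they differ modulo some normal p'-section, on which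
    one finds a character fixed by their intersection but not by P.

    From G to P (exists_small_deg_Sylow): let 'O_p^'(G) = 1, let chi be irreducible of
    degree divisible by p, let q be the p-part of chi(1), and suppose that every
    irreducible character of P of degree at most q is linear. Then two distinct Sylow
    subgroups P and Q intersect in index more than q (Sylow_eq_small_index):
    otherwise induction from R, the intersection of P and Q, to P shows that P and R
    have the same derived subgroup, and so do Q and R, which makes P and Q equal
    because the p-core contains its centralizer. Now climb a series of normal
    subgroups with p- and p'-factors, keeping constituents of chi that are P-invariant,
    have degree prime to p and extend to the product with P (p'deg_over_invariant). In a
    p-factor the extension to the product may be changed by a character of P of
    degree at most q, which is linear. In a p'-factor a constituent mu has a Sylow
    subgroup R of its stabilizer in P with #|P : R| at most q; an element that
    centralizes R modulo the lower term then normalizes P, by the bound on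
    intersections, and a congruence modulo p (inertia_cent_quotient) shows that the
    normalizer of R in P fixes mu, so R = P. That the degrees stay prime to p follows
    from the divisibility of #|G : N| by the ratio of the degree of a character to
    that of an invariant constituent on N (invariant_deg_ratio), proved with
    projective representations. At the top, p does not divide chi(1).

    For the block, let X be the p'-core. The central character of a
    character in the principal block has sum #|X| over the classes inside X,
    modulo M, so X lies in the kernel. Conversely, in a p-solvable group with trivial
    p'-core, 'K - #|K| is nilpotent in the class algebra over 'F_p for every
    class K, since it annihilates the vectors fixed by the p-core in the regular
    representation (class_sum_rfix); so all central characters agree modulo M. *)


(** * Degrees *)

Section Degrees.

Variables (gT : finGroupType) (G : {group gT}).
Implicit Types (i : Iirr G) (p : nat).

Definition deg i : nat := Num.truncn ('chi_i 1%g).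

Lemma degE i : 'chi_i 1%g = (deg i)%:R.
Proof. by rewrite truncnK // Cnat_irr1. Qed.

Lemma deg_gt0 i : (0 < deg i)%N.
Proof. by have := irr1_gt0 i; rewrite (degE i) ltr0n. Qed.

Lemma deg_dvd_card i : (deg i %| #|G|)%N.
Proof. by rewrite -dvdC_nat; have := dvd_irr1_cardG i; rewrite (degE i). Qed.

Lemma deg_eq1 i : (deg i == 1)%N = ('chi_i \is a linear_char).
Proof. by rewrite qualifE /= irr_char (degE i) pnatr_eq1. Qed.

Lemma deg_lin i : 'chi_i \is a linear_char -> deg i = 1%N.
Proof. by rewrite -deg_eq1 => /eqP. Qed.

Lemma deg_pgroup p i : p.-group G -> ((deg i)`_p)%N = deg i.
Proof.
move=> pG; apply: part_pnat_id; exact: pnat_dvd (deg_dvd_card i) pG.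
Qed.

Lemma natdeg_pgroup p i : p.-group G -> p.-nat (deg i).
Proof. by move=> pG; apply: pnat_dvd (deg_dvd_card i) pG. Qed.

(** If every irreducible constituent had a larger p-part than n, the next
    power of p would divide all the terms of the sum n of their degrees. *)
Lemma small_constituent p (phi : 'CF(G)) n :
    prime p -> phi \is a character -> phi 1%g = n%:R -> (0 < n)%N ->
  exists2 i, i \in irr_constt phi & ((deg i)`_p <= n`_p)%N.
Proof.
move=> p_pr Nphi phi1 n_gt0; apply/exists_inP.
apply: contraLR (n_gt0) => /exists_inPn no_i; rewrite -leqNgt leqNgt.
apply/negP=> _.
have dvq: ((p * n`_p)%N %| phi 1%g)%C.
  rewrite (cfun_sum_constt phi) sum_cfunE rpred_sum // => i si.
  rewrite cfunE degE; have /natrP[m ->] := Cnat_cfdot_char_irr i Nphi.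
  rewrite -natrM dvdC_nat dvdn_mull //.
  have := no_i i si; rewrite -ltnNge !p_part => lt_ni.
  rewrite -expnS; apply: dvdn_trans (dvdn_part p (deg i)).
  by rewrite p_part dvdn_exp2l // -(ltn_exp2l _ _ (prime_gt1 p_pr)).
by move: dvq; rewrite phi1 dvdC_nat p_part -expnS pfactor_dvdn // ltnn.
Qed.

End Degrees.
Arguments deg {gT G} i.

Lemma deg_irr_eq (gT hT : finGroupType) (G : {group gT}) (H : {group hT})
    (i : Iirr G) (j : Iirr H) :
  'chi_i 1%g = 'chi_j 1%g -> deg i = deg j.
Proof. by rewrite /deg => ->. Qed.

(** * p-solvability through normal sections *)

(** Every normal section of G contains a nontrivial p- or p'-section that is
    normal in G; unlike a series, this form is inherited by quotients at once. *)
Definition psolv (gT : finGroupType) (p : nat) (G : {group gT}) : Prop :=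
  forall H K : {group gT}, H <| G -> K <| G -> H \proper K ->
  exists U : {group gT}, [/\ U <| G, H \proper U, U \subset K
    & p.-nat #|U : H| || p^'.-nat #|U : H| ].

Lemma index_quotient_sub (gT : finGroupType) (A B C : {group gT}) :
  B \subset A -> C \subset B -> A \subset 'N(C) -> #|A / C : B / C| = #|A : B|.
Proof.
move=> sBA sCB nCA; apply/eqP.
have sCA := subset_trans sCB sBA; have nCB := subset_trans sBA nCA.
have := Lagrange (quotientS C sBA); rewrite !card_quotient // => LAB.
rewrite -(eqn_pmul2l (indexg_gt0 B C)) LAB -(eqn_pmul2l (cardG_gt0 C)).
by rewrite mulnA !Lagrange.
Qed.

(** Intersecting a p-solvable series of G with K, take the first term that is
    not contained in H: H absorbs the previous one, so the join of H and that
    term is a section of the required kind. *)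
Lemma psolvable_psolv (gT : finGroupType) (p : nat) (G T : {group gT}) :
  psolvable p G -> T \subset G -> psolv p T.
Proof.
case=> s ser lastG sTG H K nsHT nsKT /properP[sHK [x Kx H'x]].
have [sKT nKT] := andP nsKT; have [sHT nHT] := andP nsHT.
have: K \subset last 1%G s by rewrite lastG (subset_trans sKT).
have: K :&: 1%G \subset H by rewrite (setIidPr (sub1G K)) sub1G.
elim: s {lastG} (1%G : {group gT}) ser => [|W s IHs] V /=.
  by move=> _ sVH sKV; case/negP: H'x; rewrite (subsetP sVH) // inE Kx (subsetP sKV).
case/andP=> /andP[/and3P[_ nWG nsVW] pfac] ser sVH sKs.
have [sKWH | nsKWH] := boolP (K :&: W \subset H); first exact: IHs sKWH sKs.
have nKW_T: T \subset 'N(K :&: W) by rewrite normsI // (subset_trans sTG).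
have sKWK : K :&: W \subset K by apply: subsetIl.
have nH_KW: K :&: W \subset 'N(H) by rewrite (subset_trans sKWK) ?(subset_trans sKT).
exists (H <*> (K :&: W))%G; split.
- by rewrite /normal join_subG sHT (subset_trans sKWK) //= normsY.
- by rewrite properEneq joing_subl andbT eq_sym; apply: contra nsKWH => /eqP/joing_idPl.
- by rewrite join_subG sHK.
have dv_idx: (#|H <*> (K :&: W) : H| %| #|W : V|)%N.
  rewrite norm_joinEr //.
  rewrite -card_quotient; last by rewrite mul_subG ?normG.
  rewrite quotientMidl card_quotient // -indexgI.
  have [sVW nVW] := andP nsVW.
  apply: (@dvdn_trans #|K :&: W : V|).
    rewrite -(indexgI (K :&: W) V) indexgS // subsetI subsetIl.
    by apply: subset_trans sVH; rewrite setSI // subsetIl.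
  have nV_KW: K :&: W \subset 'N(V) by rewrite (subset_trans _ nVW) ?subsetIr.
  by rewrite -!card_quotient ?cardSg ?quotientS ?subsetIr.
have [sVW nVW] := andP nsVW.
move: pfac; rewrite /pgroup !card_quotient // => /orP[] /(pnat_dvd dv_idx) -> //.
by rewrite orbT.
Qed.

Lemma psolv_quotient (gT : finGroupType) (p : nat) (G N : {group gT}) :
  N <| G -> psolv p G -> psolv p (G / N).
Proof.
move=> nsNG solG H K nsH nsK /properP[sHK [x Kx H'x]].
have [sNG nNG] := andP nsNG.
have [H1 [defH sNH sHG]] := inv_quotientN nsNG nsH.
have [K1 [defK sNK sKG]] := inv_quotientN nsNG nsK.
have sH1K1: H1 \subset K1.
  by move: sHK; rewrite defH defK quotientSGK // (subset_trans (normal_sub sHG)).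
have pHK: H1 \proper K1.
  rewrite properEneq sH1K1 andbT; apply: contraNneq H'x => eqHK.
  by rewrite defH eqHK -defK.
have [U [nsU ltHU sUK pfac]] := solG _ _ sHG sKG pHK.
have sNU := subset_trans sNH (proper_sub ltHU).
have sUG := normal_sub nsU; have nUN := subset_trans sUG nNG.
exists (U / N)%G; split.
- exact: quotient_normal.
- rewrite defH quotient_proper //; last exact: normalS sNU sUG nsNG.
  exact: normalS sNH (normal_sub sHG) nsNG.
- by rewrite defK quotientS.
by rewrite defH index_quotient_sub ?(proper_sub ltHU).
Qed.

(** * Sylow subgroups and characters of small degree *)

Section SmallDegreeGroups.

Local Open Scope group_scope.

Variables (gT : finGroupType).
Implicit Types (p : nat) (G P Q R : {group gT}).

(** The constituents of the character of P induced from a linear character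
    mu of R have degree at most #|P : R|, so they are linear; hence P^`(1)
    lies in the kernel of the induced character, which lies in that of mu. *)
Lemma der1_sub_small_index P R :
    R \subset P ->
    (forall i : Iirr P, (deg i <= #|P : R|)%N -> 'chi_i \is a linear_char) ->
  P^`(1) \subset R^`(1).
Proof.
move=> sRP linP; rewrite -[R^`(1)]cap_cfker_lin_irr; apply/bigcapsP=> j lin_j.
have sKj : cfker ('Ind[P] 'chi_j) \subset cfker 'chi_j.
  by rewrite cfker_Ind_irr // gcore_sub.
have NInd: 'Ind[P] 'chi_j \is a character by rewrite cfInd_char ?irr_char.
apply: subset_trans sKj; rewrite cfkerE // subsetI der_sub.
apply/bigcapsP=> i si; apply: lin_char_der1; apply: linP.
have := char1_ge_constt NInd si.
by rewrite cfInd1 // (lin_char1 lin_j) mulr1 degE leC_nat.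
Qed.

(** This is the Hall-Higman lemma. Otherwise G would have a normal p- or p'-section
    U / 'Z('O_p(G)) inside the centralizer of the p-core. If U is a p-group it lies
    in the p-core, hence in 'Z('O_p(G)). In the other case U is the direct product
    of 'Z('O_p(G)) and a p'-group, which is characteristic in U and so contained in
    'O_p^'(G). *)
Lemma cent_pcore_sub p G :
  psolv p G -> 'O_p^'(G) = 1 -> 'C_G('O_p(G)) \subset 'O_p(G).
Proof.
move=> solG p'G1; set N := 'O_p(G); set C := 'C_G(N).
have nsNG: N <| G by apply: pcore_normal.
have nsCG: C <| G.
  by rewrite /C norm_normalI // norms_cent // normal_norm.
have nsZG: C :&: N <| G by apply: normalI.
rewrite -[_ \subset _]negbK; apply/negP=> nsCN.
have pCN: [group of C :&: N] \proper [group of C].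
  by rewrite properE subsetIl subsetI subxx.
have [U [nsUG /properP[sZU [x Ux Z'x]] sUC]] := solG _ _ nsZG nsCG pCN.
rewrite /= in sZU Z'x sUC *.
have pZ: p.-group (C :&: N) by rewrite (pgroupS (subsetIr _ _)) ?pcore_pgroup.
case/orP=> idxU.
  have pU: p.-group U by rewrite /pgroup -(Lagrange sZU) pnatM idxU andbT.
  by case/negP: Z'x; rewrite inE (subsetP sUC) // (subsetP (pcore_max pU nsUG)).
have hallZ: p.-Hall(U) (C :&: N) by rewrite /pHall sZU pZ idxU.
have nsZU: C :&: N <| U by apply: normalS nsZG => //; apply: normal_sub.
have /splitsP[H complH] := SchurZassenhaus_split (pHall_Hall hallZ) nsZU.
have [_ defU] := complP complH.
have hallH := complH; rewrite (compl_pHall _ hallZ) in hallH.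
have cHZ: C :&: N \subset 'C(H).
  rewrite centsC; apply: subset_trans (pHall_sub hallH) _.
  by rewrite (subset_trans sUC) // (subset_trans (subsetIr _ _)) // centS ?subsetIr.
have nsHU: H <| U.
  rewrite /normal (pHall_sub hallH) -defU mul_subG ?normG //.
  exact: subset_trans cHZ (cent_sub _).
have H1: H :=: 1.
  apply/trivgP; rewrite -p'G1 -(normal_Hall_pcore hallH nsHU).
  apply: pcore_max; rewrite ?pcore_pgroup //.
  exact: char_normal_trans (pcore_char _ _) nsUG.
by case/negP: Z'x; rewrite -[C :&: N]mulg1 -H1 defU.
Qed.

(** Let R be the intersection of P and Q. By der1_sub_small_index the two Sylow
    subgroups have the same derived subgroup as R, so they both normalize R and
    centralize R / R^`(1). But the centralizer of that section in the normalizer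
    of R is a p-group: its p'-elements centralize R by coprime action, hence
    centralize the p-core, which contains its own centralizer. *)
Lemma Sylow_eq_small_index p G P Q :
    psolv p G -> 'O_p^'(G) = 1 -> p.-Sylow(G) P -> p.-Sylow(G) Q ->
    (forall i : Iirr P, (deg i <= #|P : P :&: Q|)%N -> 'chi_i \is a linear_char) ->
  P :=: Q.
Proof.
move=> solG p'G1 sylP sylQ linP.
pose R := [group of P :&: Q].
have [sPG pP _] := and3P sylP; have [sQG pQ _] := and3P sylQ.
have [sRP sRQ] : R \subset P /\ R \subset Q by rewrite subsetIl subsetIr.
have pR: p.-group R by apply: pgroupS pP.
have oPQ: #|P| = #|Q| by rewrite (card_Hall sylP) (card_Hall sylQ).
have derP: P^`(1) = R^`(1).
  by apply/eqP; rewrite eqEsubset der1_sub_small_index //=; apply: dergS.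
have sNR: 'O_p(G) \subset R by rewrite subsetI !pcore_sub_Hall.
have derQ: Q^`(1) = R^`(1).
  have [x Gx defQ] := Sylow_trans sylP sylQ.
  have oder: #|Q^`(1)| = #|P^`(1)| by rewrite defQ derJ cardJg.
  apply/eqP; rewrite eq_sym eqEcard oder -derP leqnn andbT derP.
  exact: dergS.
have nR (X : {group gT}) : R \subset X -> X^`(1) = R^`(1) -> X \subset 'N(R).
  by move=> sRX dX; rewrite sub_der1_norm // dX der_sub.
have [nRP nRQ] := (nR _ sRP derP, nR _ sRQ derQ).
pose C := [group of 'C_('N_G(R))(R / R^`(1) | 'Q)].
have inC (X : {group gT}) : X \subset G -> R \subset X -> X^`(1) = R^`(1) -> X \subset C.
  move=> sXG sRX dX; rewrite subsetI subsetI sXG nR //=.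
  have nR'X: X \subset 'N(R^`(1)) by rewrite -dX der_norm.
  rewrite sub_astabQ nR'X /= quotient_cents2 ?(subset_trans sRX) //.
  by rewrite (subset_trans (commgS _ sRX)) // -derg1 dX.
have pC: p.-group C.
  apply/pgroupP=> q q_pr /(Cauchy q_pr)[x Cx ox]; apply/idPn=> neq_qp.
  have p'x: p^'.-group <[x]>.
    by rewrite /pgroup -[#|_|]/#[x] ox pnatE.
  have nRx: <[x]> \subset 'N(R).
    by rewrite cycle_subG; move: Cx; rewrite !inE => /andP[/andP[]].
  have [nR'x cRx]: <[x]> \subset 'N(R^`(1)) /\ <[x]> / R^`(1) \subset 'C(R / R^`(1)).
    by apply/andP; rewrite -sub_astabQ cycle_subG; move: Cx => /setIP[].
  have co: coprime #|R| #|<[x]>| by apply: pnat_coprime pR p'x.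
  have sR'R: R^`(1) \subset R := der_sub 1 R.
  have defR: 'C_R(<[x]>) = R.
    have := coprime_quotient_cent sR'R nR'x co (pgroup_sol pR).
    have /setIidPl-> : R / R^`(1) \subset 'C(<[x]> / R^`(1)) by rewrite centsC.
    move=> eqCR.
    rewrite -[LHS]genGid; apply: Phi_nongen; apply/eqP.
    rewrite eqEsubset join_subG Phi_sub subsetIl /=.
    have: R \subset R^`(1) * 'C_R(<[x]>) by rewrite -quotientSK ?der_norm // eqCR.
    move/subset_trans; apply; rewrite mul_subG ?joing_subr //.
    by apply: subset_trans (joing_subl _ _); rewrite (Phi_joing pR) joing_subl.
  have xN: x \in 'O_p(G).
    apply: (subsetP (cent_pcore_sub solG p'G1)); rewrite inE.
    have -> /= : x \in G by move: Cx; rewrite !inE => /andP[/andP[]].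
    rewrite -cycle_subG centsC (subset_trans sNR) //.
    by rewrite -defR subsetIr.
  have: p.-group <[x]> by rewrite (pgroupS _ (pcore_pgroup p G)) // cycle_subG.
  by rewrite /pgroup -[#|_|]/#[x] ox pnatE // (negPf neq_qp).
have sCG: C \subset G by rewrite (subset_trans (subsetIl _ _)) ?subsetIl.
have defC1 := sub_pHall sylP pC (inC _ sPG sRP derP) sCG.
exact: etrans (esym defC1) (sub_pHall sylQ pC (inC _ sQG sRQ derQ) sCG).
Qed.

End SmallDegreeGroups.

(** * Ratios of character degrees *)

(** The central extension of hT by the integers mod n.+1 defined by a
    normalized 2-cocycle c. The proof that c is a cocycle is an argument of the
    type, which lets the type carry a group structure. *)
Section CentralExtension.

Variables (hT : finGroupType) (n : nat) (c : hT -> hT -> 'I_n.+1).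

Definition normal_cocycle : Prop :=
  [/\ forall x, c 1%g x = 0, forall x, c x 1%g = 0
    & forall x y z, c x y + c (x * y)%g z = c y z + c x (y * z)%g].

Hypothesis cocycle_c : normal_cocycle.

Definition central_ext of normal_cocycle : Type := (hT * 'I_n.+1)%type.
Local Notation eT := (central_ext cocycle_c).

HB.instance Definition _ := Finite.on eT.

Definition cext_mul (x y : eT) : eT := ((x.1 * y.1)%g, x.2 + y.2 + c x.1 y.1).
Definition cext_one : eT := (1%g, 0).
Definition cext_inv (x : eT) : eT := (x.1^-1%g, - x.2 - c x.1^-1%g x.1).

Lemma cext_mulA : associative cext_mul.
Proof.
have [_ _ cA] := cocycle_c; move=> [x i] [y j] [z k]; rewrite /cext_mul /=.
congr (_, _); first exact: mulgA.
rewrite addrA -!addrA; congr (_ + _); congr (_ + _).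
by rewrite [RHS]addrCA cA.
Qed.

Lemma cext_mul1 : left_id cext_one cext_mul.
Proof.
have [c1 _ _] := cocycle_c; case=> x i; rewrite /cext_mul /= c1 mul1g.
by rewrite add0r addr0.
Qed.

Lemma cext_mulV : left_inverse cext_one cext_inv cext_mul.
Proof.
case=> x i; rewrite /cext_mul /cext_one /= mulVg; congr (_, _).
by rewrite [LHS]addrAC subrK addNr.
Qed.

HB.instance Definition _ :=
  Finite_isGroup.Build eT cext_mulA cext_mul1 cext_mulV.

Definition cext_proj (x : eT) : hT := x.1.

Lemma cext_projM : {in [set: eT] &, {morph cext_proj : x y / (x * y)%g}}.
Proof. by []. Qed.

Canonical cext_morphism := Morphism cext_projM.

End CentralExtension.

(** Conjugation by an element of G turns rN into a similar representation, and
    B u is a matrix that realizes the similarity. *)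
Lemma projective_extension (gT : finGroupType) (G N : {group gT}) (t : Iirr N)
    n (rN : mx_representation algC N n) :
    N <| G -> G \subset 'I['chi_t] -> cfRepr rN = 'chi_t ->
  exists B : subg_of G -> 'M[algC]_n,
   [/\ B 1%g = 1%:M, forall u, \det (B u) = 1
     & forall u x, x \in N -> rN x *m B u = B u *m rN (x ^ sgval u)%g].
Proof.
move=> nsNG IGt rNt; have [sNG nNG] := andP nsNG.
have n_gt0: (0 < n)%N.
  by have := irr1_gt0 t; rewrite -rNt cfRepr1 ltr0n.
pose P (u : subg_of G) (B : 'M[algC]_n) := [/\ u = 1%g -> B = 1%:M, \det B = 1
     & forall x, x \in N -> rN x *m B = B *m rN (x ^ sgval u)%g].
suffices /fin_all_exists[B PB]: forall u, exists B, P u B.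
  by exists B; split=> [|u|u]; [case: (PB 1%g) => -> | case: (PB u) | case: (PB u)].
move=> u; have [-> | ntu] := eqVneq u 1%g.
  by exists 1%:M; split=> [||x Nx] //; rewrite ?det1 // mulmx1 mul1mx conjg1.
have Gu := subgP u; set g := sgval u in Gu *.
have nNg: {in N, forall x, x ^ g \in N}%g.
  by move=> x Nx; rewrite memJ_norm // (subsetP nNG).
have rNgP: mx_repr N (fun x => rN (x ^ g)%g).
  split=> [|x y Nx Ny]; first by rewrite conj1g repr_mx1.
  by rewrite conjMg repr_mxM ?nNg.
pose rNg := MxRepresentation rNgP.
have : cfRepr rN = cfRepr rNg.
  apply/cfun_inP=> x Nx; rewrite rNt -(inertia_valJ x (subsetP IGt _ Gu)) -rNt.
  by rewrite !cfunE nNg // Nx.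
case/cfRepr_inj => B _ freeB homB.
have nzB: \det B != 0 by rewrite -unitfE -unitmxE -row_free_unit.
(* This makes the determinant 1, so that the scalars by which the matrices B u
   fail to be multiplicative are n-th roots of unity, of which there are only
   finitely many. *)
pose a := (n.-root (\det B))^-1.
exists (a *: B); split=> [u1||x Nx]; first by case/eqP: ntu.
  by rewrite detZ exprVn rootCK // mulVf.
by rewrite -scalemxAr homB // -scalemxAl.
Qed.

(** The projective extension of chi_t to G becomes an ordinary representation of
    the finite central extension hT of G defined by its cocycle. On the preimage K
    of N it differs from the inflation of chi_t by scalars, which form the linear
    character e. *)
Lemma projective_cover (gT : finGroupType) (G N : {group gT}) (t : Iirr N) :
    N <| G -> G \subset 'I['chi_t] ->
  exists (hT : finGroupType) (f : {morphism [set: hT] >-> gT})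
         (K : {group hT}) (s : Iirr [set: hT]) (e : Iirr K),
    [/\ G :=: (f @* [set: hT])%g, N :=: (f @* K)%g & ('ker f \subset K)%g]
 /\ [/\ K <| [set: hT], 'chi_e \is a linear_char, [set: hT] \subset 'I['chi_e]
      & {in K, forall y, 'chi_s y = 'chi_e y * 'chi_t (f y)}].
Proof.
move=> nsNG IGt; have [sNG nNG] := andP nsNG.
have /irr_reprP[[n rN] /= irrN rNt] := mem_irr t.
have [B [B1 detB homB]] := projective_extension nsNG IGt (esym rNt).
case: n => [|d] in rN irrN rNt B B1 detB homB.
  by case/mx_irrP: irrN.
have absN: mx_absolutely_irreducible rN by apply: groupC.
have uB u: B u \in unitmx by rewrite unitmxE detB unitr1.
have BZ_inj u a b: a *: B u = b *: B u -> a = b.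
  move/(congr1 (mulmxr (invmx (B u)))); rewrite /= -!scalemxAl mulmxV //.
  by rewrite !scalemx1 => /matrixP/(_ 0 0); rewrite !mxE eqxx.
have [z prim_z] := C_prim_root_exists (ltn0Sn d).
have zX_inj (i j : 'I_d.+1) : z ^+ i = z ^+ j -> i = j.
  move/eqP; rewrite (eq_prim_root_expr prim_z) !modn_small // => /eqP.
  exact: val_inj.
have zXD (i j : 'I_d.+1) : z ^+ (i + j)%R = z ^+ i * z ^+ j.
  by rewrite -exprD -(prim_expr_mod prim_z (i + j)).
have cent_scal A: (forall x, x \in N -> rN x *m A = A *m rN x) ->
  exists a, A = a%:M.
  move=> cA; apply/is_scalar_mxP; apply: (mx_abs_irr_cent_scalar absN).
  by apply/centgmxP=> x Nx; rewrite cA.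
have cex u v: exists c : 'I_d.+1, B u *m B v = z ^+ c *: B (u * v)%g.
  pose A := B u *m B v *m invmx (B (u * v)%g).
  have [|a defA] := cent_scal A.
    move=> x Nx; rewrite /A.
    have nNu: (x ^ sgval u)%g \in N by rewrite memJ_norm ?(subsetP nNG) ?subgP.
    have: B (u * v)%g *m rN ((x ^ sgval u) ^ sgval v)%g = rN x *m B (u * v)%g.
      by rewrite homB ?conjgM.
    move/(canRL (mulKmx (uB _))) => hom2.
    have {}hom2: rN ((x ^ sgval u) ^ sgval v)%g *m invmx (B (u * v)%g)
                   = invmx (B (u * v)%g) *m rN x.
      by rewrite hom2 mulmxA mulmxK.
    by rewrite !mulmxA homB // -(mulmxA _ _ (B v)) homB // -!mulmxA hom2.
  have a1: a ^+ d.+1 = 1.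
    by rewrite -det_scalar -defA !det_mulmx det_inv !detB invr1 !mulr1.
  have [c def_a] := prim_rootP prim_z a1.
  by exists c; rewrite -def_a -mul_scalar_mx -defA /A mulmxKV.
have [c defc] : exists c : subg_of G -> subg_of G -> 'I_d.+1,
    forall u v, B u *m B v = z ^+ c u v *: B (u * v)%g.
  have /fin_all_exists[c Dc] u := fin_all_exists (cex u).
  by exists c.
have cocycle_c: normal_cocycle c.
  split=> [u|u|u v w].
  - apply: zX_inj; apply: (BZ_inj u); rewrite scale1r.
    by have := defc 1%g u; rewrite B1 mul1mx mul1g.
  - apply: zX_inj; apply: (BZ_inj u); rewrite scale1r.
    by have := defc u 1%g; rewrite B1 mulmx1 mulg1.
  apply: zX_inj; apply: (BZ_inj (u * v * w)%g); rewrite !zXD.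
  rewrite -scalerA -defc scalemxAl -defc -mulmxA defc -scalemxAr defc.
  by rewrite mulgA scalerA.
pose hT : finGroupType := central_ext cocycle_c.
pose fT (x : hT) : gT := sgval x.1.
have fM : {in [set: hT] &, {morph fT : x y / (x * y)%g}} by [].
pose f := Morphism fM.
pose R (x : hT) : 'M[algC]_d.+1 := z ^+ (x.2 : 'I_d.+1) *: B x.1.
have R_repr : mx_repr [set: hT] R.
  split=> [|x y _ _]; first by rewrite /R /= B1 scale1r.
  have RE a i : R (a, i) = z ^+ (i : 'I_d.+1) *: B a by [].
  have -> : (x * y)%g = ((x.1 * y.1)%g, x.2 + y.2 + c x.1 y.1) :> hT by [].
  by rewrite RE !zXD /R -scalemxAl -scalemxAr defc !scalerA.
pose rR := MxRepresentation R_repr.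
pose K := (f @*^-1 N)%G.
have fG: (f @* [set: hT])%g = G.
  apply/setP=> x; apply/morphimP/idP=> [[y _ _ ->] | Gx]; first exact: subgP.
  by exists ((subg G x, 0) : hT); rewrite ?inE // /= /fT /= subgK.
have fK: (f @* K)%g = N by rewrite morphpreK ?fG.
have memK y: (y \in K) = (f y \in N) by rewrite !inE.
have hom_R y x: x \in N -> rN x *m R y = R y *m rN (x ^ f y)%g.
  by move=> Nx; rewrite -scalemxAr homB // -scalemxAl.
pose e0 y := (R y *m rN (f y)^-1%g) 0 0.
have scalR y: y \in K -> R y = e0 y *: rN (f y).
  rewrite memK => Ny.
  have [|a Da] := cent_scal (R y *m rN (f y)^-1%g).
    move=> x Nx; rewrite mulmxA hom_R // -!mulmxA -!repr_mxM ?groupV ?groupJ //.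
    by rewrite conjgE -!mulgA mulgV mulg1.
  have ->: e0 y = a by rewrite /e0 Da mxE eqxx.
  rewrite -mul_scalar_mx -Da -mulmxA -repr_mxM ?groupV //.
  by rewrite mulVg repr_mx1 mulmx1.
have uR y: R y \in unitmx by rewrite (repr_mx_unit rR) ?inE.
have rN_inj a b x: x \in N -> a *: rN x = b *: rN x -> a = b.
  move=> Nx /(congr1 (mulmxr (rN x^-1%g))); rewrite /= -!scalemxAl -repr_mxM ?groupV //.
  rewrite mulgV repr_mx1 !scalemx1 => /matrixP/(_ 0 0).
  by rewrite !mxE eqxx.
have e0_repr : mx_repr K (fun y => (e0 y)%:M : 'M[algC]_1).
  split=> [|x y Kx Ky].
    congr (_%:M); apply: (rN_inj _ _ 1%g (group1 N)).
    have := scalR _ (group1 K); rewrite morph1 scale1r repr_mx1 => <-.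
    exact: repr_mx1 rR.
  rewrite -scalar_mxM; congr (_%:M).
  have [Nx Ny] : f x \in N /\ f y \in N by rewrite -!memK.
  have Nxy : f (x * y)%g \in N by rewrite -memK groupM.
  apply: (rN_inj _ _ _ Nxy); rewrite -scalR ?groupM // -[R _]/(rR _).
  rewrite (repr_mxM rR) ?inE //.
  rewrite [rR x]scalR // [rR y]scalR // (morphM f) ?inE // repr_mxM //.
  by rewrite -scalemxAl -scalemxAr scalerA.
pose rE := MxRepresentation e0_repr.
have lin_e: cfRepr rE \is a linear_char.
  by rewrite qualifE /= cfRepr_char cfRepr1 /=.
have irrR: mx_irreducible rR.
  apply/mx_irrP; split=> // U /mxmoduleP modU nzU.
  have [_ irrU] := (mx_irrP rN).1 irrN.
  apply: irrU nzU; apply/mxmoduleP=> x; rewrite -{1}fK => /morphimP[y _ Ky ->].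
  have := modU y (in_setT y); rewrite [rR y]scalR // -scalemxAr.
  rewrite eqmx_scale //; apply: contraTneq (uR y) => e0y.
  by rewrite scalR // e0y scale0r unitmxE det0 unitr0.
have /irrP[s def_s]: cfRepr rR \in irr [set: hT].
  by apply/irr_reprP; exists (Representation rR).
have /irrP[e def_e] := lin_char_irr lin_e.
have nsK: K <| [set: hT].
  rewrite -[X in _ <| X](_ : f @*^-1 G = _)%g ?morphpre_normal ?fG //.
  by apply/setP=> y; rewrite !inE; apply: subgP.
exists hT, f, K, s, e; split; first by split; rewrite ?fG ?fK ?ker_sub_pre.
split=> //; first by rewrite -def_e.
  apply/subsetP=> h _; rewrite inE (subsetP (normal_norm nsK)) ?inE //=.
  apply/eqP/cfun_inP=> y Ky; have Ty := in_setT y; have Th := in_setT h.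
  have KyJ : (y ^ h^-1)%g \in K by rewrite memJ_norm ?groupV // (subsetP (normal_norm nsK)).
  rewrite cfConjgE ?(subsetP (normal_norm nsK)) // -def_e !cfunE KyJ Ky.
  rewrite !mxtrace_scalar; congr (_ *+ _ *+ _).
  have Nf: f (y ^ h^-1)%g \in N by rewrite -memK.
  apply: (rN_inj _ _ _ Nf); rewrite -scalR // -[R _]/(rR _).
  have {1}->: (y ^ h^-1 = h * y * h^-1)%g by rewrite conjgE invgK mulgA.
  rewrite (repr_mxM rR) ?inE // (repr_mxM rR) ?inE // [rR y]scalR //.
  rewrite -(scalemxAr (e0 y)) -(scalemxAl (e0 y)); apply: congr1.
  have -> : rN (f y) = rN (f (y ^ h^-1)%g ^ f h)%g.
    by rewrite -morphJ ?inE // conjgKV.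
  by rewrite -hom_R // -mulmxA -(repr_mxM rR) ?inE // mulgV repr_mx1 mulmx1.
move=> y Ky; rewrite -def_s -def_e rNt !cfunE Ky -memK Ky inE.
by rewrite [rR y]scalR // mxtraceZ mxtrace_scalar.
Qed.

(** The ratio of the degree of a character to that of an invariant constituent
    of its restriction to N is the degree of a projective character of G / N:
    on a central extension where the constituent extends, up to a linear
    character e, the ratio is the degree of a character lying over the inverse
    of e, and the preimage of N lies in the center of the latter. *)
Theorem invariant_deg_ratio (gT : finGroupType) (G N : {group gT})
    (t : Iirr N) (i : Iirr G) :
    N <| G -> G \subset 'I['chi_t] -> t \in irr_constt ('Res[N] 'chi_i) ->
  exists2 e, deg i = (e * deg t)%N & (e %| #|G : N|)%N.
Proof.
move=> nsNG IGt; have [sNG nNG] := andP nsNG.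
have [hT [f [K [s [e [[eqG eqN sKer] [nsK lin_e Ie def_s]]]]]]] :=
  projective_cover nsNG IGt.
have {eqG}eqG : G = (f @* [set: hT])%G by apply: group_inj.
have {eqN}eqN : N = (f @* K)%G by apply: group_inj.
subst G N => Nti; have [sKT nKT] := andP nsK.
have irr_th : cfMorph 'chi_t \in irr K.
  by rewrite cfMorph_irr ?subsetT //; apply: mem_irr.
have irr_ch : cfMorph 'chi_i \in irr [set: hT].
  by rewrite cfMorph_irr ?subsetT //; apply: mem_irr.
have /irrP[j def_j] : ('chi_e)^*%CF \in irr K by rewrite lin_char_irr ?cfConjC_lin_char.
have lin_j : 'chi_j \is a linear_char by rewrite -def_j cfConjC_lin_char.
have def_th : 'Res[K] 'chi_s = 'chi_e * cfMorph 'chi_t.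
  by apply/cfun_inP=> y Ky; rewrite cfResE // def_s // cfunE cfMorphE.
have irr_th' : 'chi_e * cfMorph 'chi_t \in irr K by rewrite mul_lin_irr.
have /irrP[u def_u] := irr_th'.
have def_jth : 'chi_j * 'chi_u = cfMorph 'chi_t.
  by rewrite -def_u -def_j mulrCA mulrA mul_conjC_lin_char // mul1r.
have Ij : [set: hT] \subset 'I['chi_j].
  apply/subsetP=> y Ty; rewrite inE (subsetP nKT) // -def_j -conj_cfConjg.
  by rewrite (inertiaJ (subsetP Ie y Ty)) eqxx.
have def_su : 'Res[K] 'chi_s = 'chi_u by rewrite def_th.
have irr_ju : 'chi_j * 'chi_u \in irr K by rewrite def_jth.
have [_ _ img _] := constt_Ind_mul_ext nsK def_su Ij irr_ju.
have /irrP[a def_a] := irr_ch; have /irrP[b def_b] := irr_th.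
have sa : a \in irr_constt ('Ind[[set: hT]] ('chi_j * 'chi_u)).
  rewrite def_jth def_b constt_Ind_Res irr_consttE -def_a -def_b.
  have -> : 'Res[K] (cfMorph 'chi_i) = cfMorph ('Res[f @* K] 'chi_i).
    apply/cfun_inP=> y Ky; rewrite cfResE // !cfMorphE ?subsetT ?inE //.
    by rewrite cfResE ?morphimS ?mem_morphim ?inE.
  by rewrite cfMorph_iso ?subsetT // -irr_consttE.
move: sa; rewrite img => /imageP[c sc def_ac].
have irr_cs : 'chi_c * 'chi_s \in irr [set: hT].
  by have [irrM _ _ _] := constt_Ind_mul_ext nsK def_su Ij irr_ju; apply: irrM.
have def_cs : cfMorph 'chi_i = 'chi_c * 'chi_s by rewrite def_a def_ac cfIirrE.
have deg_s : 'chi_s 1%g = 'chi_t 1%g.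
  by rewrite def_s ?group1 // (lin_char1 lin_e) mul1r morph1.
exists (deg c).
  apply/eqP; rewrite -eqC_nat natrM -!degE -deg_s.
  have := congr1 (fun phi : 'CF(_) => phi 1%g) def_cs.
  by rewrite /= cfMorph1 cfunE => ->.
have -> : #|f @* [set: hT] : f @* K| = #|[set: hT] : K|.
  rewrite -(index_morphim_ker f sKT (subxx _)).
  have -> : #|[set: hT] :&: 'ker f : K| = 1%N by apply/eqP; rewrite setTI indexg_eq1.
  by rewrite muln1.
have sKZ : K \subset 'Z('chi_c)%CF.
  move: sc; rewrite constt_Ind_Res => sc.
  have def_c := Clifford_Res_sum_cfclass nsK sc.
  rewrite cfclass_invariant // big_seq1 in def_c.
  apply/subsetP=> y Ky; rewrite irr_cfcenterE ?inE //.
  rewrite -(cfResE _ sKT Ky) -(cfResE _ sKT (group1 K)) def_c !cfunE.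
  rewrite normrM normC_lin_char // lin_char1 // ger0_norm //.
  by rewrite natr_ge0 // Cnat_cfdot_char_irr // cfRes_char ?irr_char.
apply: (@dvdn_trans #|[set: hT] : 'Z('chi_c)%CF|); last exact: indexgS.
by have := dvd_irr1_index_center c; rewrite degE dvdC_nat.
Qed.

(** * Congruences for sums over actions of p-groups *)

(** The points moved by Q fall into orbits of size divisible by p, on which f is
    constant. The additive predicate I is the sense in which multiples of p are
    negligible. *)
Lemma sum_afix_ind (aT : finGroupType) (sT : finType) (D : {group aT})
    (to : action D sT) (p : nat) (Q : {group aT}) (S : {set sT}) (V : zmodType)
    (f : sT -> V) (I : V -> Prop) :
    p.-group Q -> [acts Q, on S | to] ->
    {in S & Q, forall x a, f (to x a) = f x} ->
    I 0 -> (forall u v, I u -> I v -> I (u + v)) ->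
    {in S, forall x n, I (f x *+ (p * n))} ->
  I (\sum_(x in S) f x - \sum_(x in 'Fix_(S | to)(Q)) f x).
Proof.
move=> pQ actQ fQ I0 ID If; have sQD := acts_dom actQ.
pose S1 := S :\: 'Fix_to(Q).
have actS1: [acts Q, on S1 | to].
  rewrite actsD //; have := acts_subnorm_fix to Q; rewrite (setIidPr sQD).
  by apply: subset_trans; rewrite subsetI sQD normG.
rewrite (big_setID ('Fix_to(Q))) /= addrAC subrr add0r.
rewrite -/S1 (set_partition_big _ (orbit_partition actS1)) /=.
apply: big_ind => // A /imsetP[x S1x ->].
have [Fx Sx] := setDP S1x.
have sAS : orbit to Q x \subset S by rewrite acts_sub_orbit.
rewrite (eq_bigr (fun _ => f x)) => [|y /orbitP[a Qa <-]]; last exact: fQ.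
rewrite sumr_const.
have /dvdnP[k ->]: (p %| #|orbit to Q x|)%N.
  have: p.-nat #|orbit to Q x|.
    by rewrite card_orbit_in //; apply: pnat_dvd (dvdn_indexg _ _) pQ.
  case/p_natP=> [[|k] ok]; last by rewrite ok expnS dvdn_mulr.
  by case/negP: Sx; apply/orbit1P; apply: card_orbit1.
by rewrite mulnC; apply: If.
Qed.

Lemma sum_afix_mod (aT : finGroupType) (sT : finType) (D : {group aT})
    (to : action D sT) (p : nat) (Q : {group aT}) (S : {set sT}) (f : sT -> algC) :
    p.-group Q -> [acts Q, on S | to] ->
    {in S, forall x, f x \in Aint} ->
    {in S & Q, forall x a, f (to x a) = f x} ->
  (\sum_(x in S) f x == \sum_(x in 'Fix_(S | to)(Q)) f x %[mod p])%A.
Proof.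
move=> pQ actQ Sf fQ; rewrite /eqAmod.
apply: (sum_afix_ind (I := fun u => (p%:R %| u)%A) pQ actQ fQ) => [|u v|x Sx n].
- exact: rpred0.
- exact: rpredD.
rewrite -[_ *+ (p * n)]mulr_natl natrM -mulrA -eqAmod0 eqAmodMr0 //.
by rewrite rpredM ?rpred_nat ?Sf.
Qed.

(** * Invariance under elements that centralize a section *)

Section RelativeInvariance.

Variables (gT : finGroupType) (p : nat).
Implicit Types (U V J R : {group gT}) (z : gT).
Hypothesis p_pr : prime p.

(** The characters over a fixed constituent differ by linear characters of
    J / U, on which z acts trivially. So conjugation by z multiplies the
    character by a linear character whose order divides both a power of p
    and #|J : U|. *)
Lemma irr_conjg_abelian_quo U J z (t : Iirr U) (b : Iirr J) :
    U <| J -> abelian (J / U) -> p^'.-nat #|J : U| ->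
    p.-elt z -> z \in 'N(J) -> z \in 'N(U) ->
    (forall y, y \in J -> [~ y, z]%g \in U) ->
    ('chi_t ^ z)%CF = 'chi_t -> t \in irr_constt ('Res[U] 'chi_b) ->
  ('chi_b ^ z)%CF = 'chi_b.
Proof.
move=> nsUJ abJU p'JU p_z nJz nUz cJUz tz sb; have [sUJ nUJ] := andP nsUJ.
have irrbz : ('chi_b ^ z)%CF \in irr J by rewrite cfConjg_irr ?mem_irr.
have [k def_bz] : exists k : Iirr (J / U),
    ('chi_b ^ z)%CF = ('chi_k %% U)%CF * 'chi_b.
  have lin_k (k : Iirr (J / U)) : ('chi_k %% U)%CF \is a linear_char.
    by rewrite cfMod_lin_char //; apply/char_abelianP.
  have Ind1 : 'Ind[J] (1 : 'CF(U)) = \sum_k ('chi[J / U]_k %% U)%CF.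
    have := @constt_Ind_ext _ J U 0 0 nsUJ; rewrite !irr0.
    case=> [|_ _ _ ->]; first exact: rmorph1.
    apply: eq_bigr => k _; rewrite lin_char1 ?scale1r; last exact/char_abelianP.
    by rewrite /mul_mod_Iirr /mul_Iirr irr0 mulr1 irrK mod_IirrE.
  have nz: '['Ind[J] ('Res[U] 'chi_b), ('chi_b ^ z)%CF] != 0.
    rewrite -cfdot_Res_r -cfConjgRes_norm //.
    have sbz: t \in irr_constt ('Res[U] 'chi_b ^ z)%CF.
      by rewrite irr_consttE -tz cfConjg_iso -irr_consttE.
    have NRb : 'Res[U] 'chi_b \is a character by rewrite cfRes_char ?irr_char.
    apply/eqP=> ort0; have NRbz := cfConjg_char z NRb.
    have /eqP := constt_ortho_char NRb NRbz sb sbz ort0.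
    by rewrite cfnorm_irr oner_eq0.
  have def_Ind: 'Ind[J] ('Res[U] 'chi_b) = \sum_k ('chi[J / U]_k %% U)%CF * 'chi_b.
    by rewrite -['Res _]mul1r cfIndM // Ind1 mulr_suml.
  have /existsP[k nz_k]: [exists k, '[('chi_k %% U)%CF * 'chi_b, 'chi_b ^ z] != 0].
    apply: contraR nz; rewrite negb_exists => /forallP k0.
    rewrite def_Ind cfdot_suml big1 // => k _; apply/eqP; have := k0 k.
    by rewrite negbK.
  exists k; have /irrP[a def_a] := irrbz.
  have /irrP[c def_c] := mul_lin_irr (lin_k k) (mem_irr b).
  move: nz_k; rewrite def_a def_c cfdot_irr pnatr_eq0 eqb0 negbK.
  by move/eqP->.
have [lin_k nz_k] : ('chi_k %% U)%CF \is a linear_char /\ U \subset cfker ('chi_k %% U)%CF.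
  by split; [rewrite cfMod_lin_char //; apply/char_abelianP | rewrite cfker_mod].
set xi := ('chi_k %% U)%CF in def_bz lin_k nz_k.
have xiz: (xi ^ z)%CF = xi.
  apply/cfun_inP=> y Jy; rewrite cfConjgE //; set y1 := (y ^ z^-1)%g.
  have Jy1: y1 \in J by rewrite memJ_norm ?groupV.
  have defy : (y1 * [~ y1, z])%g = y by rewrite -conjg_mulR conjgKV.
  by rewrite -[in RHS]defy [RHS]cfkerMr ?(subsetP nz_k) ?cJUz.
have def_bzn n : ('chi_b ^ (z ^+ n)%g)%CF = xi ^+ n * 'chi_b.
  elim: n => [|n IHn]; first by rewrite cfConjgJ1 mul1r.
  rewrite expgSr cfConjgMnorm ?groupX // IHn rmorphM rmorphXn /=.
  by rewrite xiz def_bz mulrA exprSr.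
pose m := #|J : U|; have co_zm: coprime #[z] m by apply: pnat_coprime p_z p'JU.
have xim: xi ^+ m = 1.
  apply/eqP; rewrite -dvdn_cforder; apply/dvdn_cforderP=> y Jy.
  have Um : (y ^+ m)%g \in U.
    have nUy : y \in 'N(U) by apply: (subsetP nUJ).
    rewrite coset_idr ?groupX // morphX //; apply/eqP.
    by rewrite -order_dvdn /m -card_quotient // order_dvdG // mem_quotient.
  by rewrite -lin_charX // cfker1 ?(subsetP nz_k) ?(lin_char1 lin_k).
(* With n divisible by #[z] and n = 1 modulo m, conjugation by z ^+ n is trivial
   but multiplies chi_b by xi. *)
pose n := chinese #[z] m 0 1.
have zn1: (z ^+ n = 1)%g.
  by apply/eqP; rewrite -order_dvdn /dvdn (chinese_modl co_zm) mod0n.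
have xin: xi ^+ n = xi.
  by rewrite -[RHS]expr1 -(expr_mod n xim) (chinese_modr co_zm) (expr_mod 1 xim).
by rewrite def_bz -xin -def_bzn zn1 cfConjgJ1.
Qed.

(** The elements of U add up to a scalar in an irreducible representation of V,
    and U acts trivially if the scalar is nonzero. *)
Lemma sum_coset_irr U V (i : Iirr V) x :
    U <| V -> x \in V ->
  \sum_(u in U) 'chi_i (x * u)%g
    = if U \subset cfker 'chi_i then #|U|%:R * 'chi_i x else 0.
Proof.
move=> nsUV Vx; have [sUV nUV] := andP nsUV; have VU := subsetP sUV.
case: ifPn => [kerU | not_kerU].
  rewrite mulr_natl -sumr_const; apply: eq_bigr => u Uu.
  by rewrite cfkerMr // (subsetP kerU).
have /irr_reprP[[n rV] /= irrV def_i] := mem_irr i.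
pose S := \sum_(u in U) rV u.
have rS g : g \in V -> rV g *m S = S *m rV g.
  move=> Vg; rewrite mulmx_sumr mulmx_suml [RHS](reindex_inj (conjg_inj g^-1%g)) /=.
  apply: eq_big => [u|u Uu]; first by rewrite memJ_norm ?groupV // (subsetP nUV).
  by rewrite -!repr_mxM ?groupJ ?groupV ?(VU u) // -conjgCV.
have /is_scalar_mxP[a defS]: is_scalar_mx S.
  apply: (mx_abs_irr_cent_scalar (groupC irrV)); apply/centgmxP=> g Vg.
  by rewrite rS.
have a0: a = 0.
  apply: contraNeq not_kerU => nz_a; rewrite def_i cfker_repr.
  apply/subsetP=> v Uv; rewrite inE VU //= mul1mx; apply/eqP.
  have: rV v *m S = S.
    rewrite mulmx_sumr [RHS](reindex_inj (mulgI v)) /=.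
    apply: eq_big => [u|u Uu]; first by rewrite groupMl.
    by rewrite repr_mxM ?VU.
  rewrite defS mul_mx_scalar -(scalemx1 _ a) => /(congr1 ( *:%R a^-1)).
  by rewrite !scalerA mulVf // !scale1r.
transitivity (\tr (rV x *m S)); last by rewrite defS a0 mul_mx_scalar scale0r mxtrace0.
rewrite mulmx_sumr raddf_sum /=; apply: eq_bigr => u Uu.
by rewrite def_i cfunE groupM ?(VU u) // repr_mxM ?(VU u).
Qed.

(** The average of a character over the cosets of U is a character of the
    quotient: keep the constituents that have U in their kernel. *)
Lemma coset_average U V (phi : 'CF(V)) :
    U <| V -> phi \is a character ->
  exists psi : 'CF(V / U),
    [/\ psi \is a character,
        forall x, x \in V -> #|U|%:R * psi (coset U x) = \sum_(u in U) phi (x * u)%g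
      & \sum_(x in (V / U)%g) psi x = #|V : U|%:R * '[phi, 1]].
Proof.
move=> nsUV Nphi; have [sUV nUV] := andP nsUV.
pose psi : 'CF(V / U) := \sum_k '[phi, 'chi_(mod_Iirr k)] *: 'chi_k.
exists psi; split=> [|x Vx|].
- apply: rpred_sum => k _; apply: rpredZ_nat; last exact: irr_char.
  exact: Cnat_cfdot_char_irr.
- rewrite [in RHS](cfun_sum_cfdot phi).
  transitivity (\sum_i '[phi, 'chi_i] * \sum_(u in U) 'chi_i (x * u)%g); last first.
    under eq_bigr do rewrite mulr_sumr.
    rewrite exchange_big /=; apply: eq_bigr => u _.
    by rewrite sum_cfunE; apply: eq_bigr => i _; rewrite cfunE.
  rewrite sum_cfunE mulr_sumr.
  rewrite (bigID (fun i : Iirr V => U \subset cfker 'chi_i)) /= [X in _ + X]big1 ?addr0.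
    rewrite (reindex (fun k : Iirr (V / U) => mod_Iirr k)) /=; last first.
      exists (fun i => quo_Iirr U i) => [k _ | i ker_i].
        by rewrite mod_IirrK.
      by rewrite quo_IirrK.
    apply: eq_big => [k | k _]; first by rewrite mod_IirrE ?cfker_mod.
    rewrite sum_coset_irr // mod_IirrE // cfker_mod // cfunE cfModE //.
    by rewrite mulrCA.
  by move=> i not_ker; rewrite sum_coset_irr // (negPf not_ker) mulr0.
have -> : \sum_(x in (V / U)%g) psi x = #|(V / U)%g|%:R * '[psi, 1].
  rewrite cfdotE mulrA mulfV ?neq0CG // mul1r.
  by apply: eq_bigr => x Vx; rewrite cfun1E Vx rmorph1 mulr1.
rewrite card_quotient //; congr (_ * _).
rewrite cfdot_suml (bigD1 0) //= big1 ?addr0 => [|k nz_k].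
  by rewrite cfdotZl mod_Iirr0 !irr0 cfnorm1 mulr1.
by rewrite cfdotZl -irr0 cfdot_irr (negPf nz_k) mulr0.
Qed.

(** If z moved chi_m, then the averages over cosets of U of |chi_m|^2 and of
    chi_m times the conjugate of its image under z would have sums #|V : U| and
    0 over V / U. Modulo p only the cosets centralized by R count, and on those
    z fixes chi_m, so p would divide #|V : U|. *)
Lemma inertia_cent_quotient U V R z (t : Iirr U) (m : Iirr V) :
    U <| V -> p^'.-nat #|V : U| -> p.-group R -> R \subset 'N(V) ->
    R \subset 'N(U) -> p.-elt z -> z \in 'N(V) -> z \in 'N(U) -> z \in 'N(R) ->
    V \subset 'I['chi_t] -> ('chi_t ^ z)%CF = 'chi_t ->
    t \in irr_constt ('Res[U] 'chi_m) -> R \subset 'I['chi_m] ->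
    (forall y, y \in V -> (forall r, r \in R -> [~ y, r]%g \in U) ->
       [~ y, z]%g \in U) ->
  ('chi_m ^ z)%CF = 'chi_m.
Proof.
move=> nsUV p'VU pR nVR nUR p_z nVz nUz nRz IVt tz tm IRm cz.
have [sUV nUV] := andP nsUV.
have fix_coset y: y \in V -> (forall r, r \in R -> [~ y, r]%g \in U) ->
  forall u, u \in U -> ('chi_m ^ z)%CF (y * u)%g = 'chi_m (y * u)%g.
(* The constituents of the restriction of chi_m to J, the subgroup generated by U
   and y, lie over chi_t, so they are fixed by z. *)
- move=> Vy cyR u Uu; have cyz := cz y Vy cyR.
  pose J := (U <*> <[y]>)%G.
  have nUy: y \in 'N(U) := subsetP nUV y Vy.
  have sJV: J \subset V by rewrite join_subG sUV cycle_subG.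
  have nsUJ: U <| J := normalS (joing_subl _ _) sJV nsUV.
  have defJ: J :=: (U * <[y]>)%g by rewrite /= norm_joinEr ?cycle_subG.
  have quoJ: (J / U = <[coset U y]>)%g.
    by rewrite /= norm_joinEr ?cycle_subG // quotientMidl quotient_cycle.
  have abJU: abelian (J / U)%g.
    by rewrite quoJ cycle_abelian.
  have cJz x: x \in J -> [~ x, z]%g \in U.
    move=> Jx; have nUx: x \in 'N(U) := subsetP nUV x (subsetP sJV x Jx).
    have Jbx: coset U x \in <[coset U y]>%g by rewrite -quoJ mem_quotient.
    rewrite coset_idr ?groupR // morphR //; apply/eqP/commgP.
    rewrite /=; case/cycleP: Jbx => k ->; apply/commute_sym/commuteX/commute_sym.
    by apply/commgP; rewrite -morphR //= coset_id.
  have nJz: z \in 'N(J).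
    rewrite inE; apply/subsetP=> _ /imsetP[x Jx ->]; rewrite conjg_mulR groupM //.
    by rewrite (subsetP (joing_subl _ _)) ?cJz.
  have Jyu: (y * u)%g \in J.
    by rewrite groupM ?(subsetP (joing_subl _ _) u) // (subsetP (joing_subr _ _)) ?cycle_id.
  have p'JU: p^'.-nat #|J : U| by apply: (pnat_dvd (indexSg _ sJV)); rewrite ?joing_subl.
  have RJz: ('Res[J] 'chi_m ^ z)%CF = 'Res[J] 'chi_m.
    rewrite (cfun_sum_constt ('Res[J] 'chi_m)) linear_sum /=.
    apply: eq_bigr => b sb; rewrite linearZ /=; congr (_ *: _).
    apply: (irr_conjg_abelian_quo nsUJ abJU p'JU p_z nJz nUz cJz tz).
    have NRm: 'Res[J] 'chi_m \is a character by rewrite cfRes_char ?irr_char.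
    have [w sw] : exists w, w \in irr_constt ('Res[U] 'chi_b).
      exact/neq0_has_constt/Res_irr_neq0.
    have := constt_Res_trans NRm sb sw; rewrite cfResRes ?(normal_sub nsUJ) //.
    rewrite (Clifford_Res_sum_cfclass nsUV tm) cfclass_invariant // big_seq1.
    rewrite irr_consttE cfdotZl cfdot_irr mulf_eq0 pnatr_eq0 eqb0 negb_or negbK.
    by case/andP=> _ /eqP->.
  rewrite -(cfResE _ sJV Jyu) -cfConjgRes_norm // RJz.
  by rewrite cfResE.
apply/eqP; apply: contraLR (p'VU) => m'z.
have irrmz : ('chi_m ^ z)%CF \in irr V by rewrite cfConjg_irr ?mem_irr.
have NM (phi psi : 'CF(V)) : phi \in irr V -> psi \in irr V ->
    phi * psi^*%CF \is a character.
  by move=> /irrP[a ->] /irrP[b ->]; rewrite rpredM ?cfConjC_char ?irr_char.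
have [psi1 [Npsi1 avg1 sum1]] := coset_average nsUV (NM _ _ (mem_irr m) (mem_irr m)).
have [psi2 [Npsi2 avg2 sum2]] := coset_average nsUV (NM _ _ (mem_irr m) irrmz).
have cfdotM1 (phi psi : 'CF(V)) : '[phi * psi^*%CF, 1] = '[phi, psi].
  rewrite !cfdotE; congr (_ * _); apply: eq_bigr => x Vx.
  by rewrite cfun1E Vx rmorph1 mulr1 !cfunE.
have psi2_0: \sum_(x in (V / U)%g) psi2 x = 0.
  rewrite sum2 cfdotM1 -conjg_IirrE cfdot_irr -(inj_eq irr_inj) conjg_IirrE.
  by rewrite eq_sym (negPf m'z) mulr0.
have psi1_1: \sum_(x in (V / U)%g) psi1 x = #|V : U|%:R.
  by rewrite sum1 cfdotM1 cfnorm_irr mulr1.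
have nUinj a b : #|U|%:R * a = #|U|%:R * b :> algC -> a = b.
  by apply: mulfI; rewrite neq0CG.
have IRmz: R \subset 'I['chi_m ^ z].
  by rewrite -conjg_inertia // -(normP nRz) conjSg.
have inv_psi (xi : 'CF(V)) (psi : 'CF(V / U)) :
    R \subset 'I[xi] ->
    (forall x, x \in V -> #|U|%:R * psi (coset U x)
       = \sum_(u in U) ('chi_m * xi^*%CF) (x * u)%g) ->
    {in (V / U)%g & (R / U)%g, forall x a, psi (x ^ a)%g = psi x}.
  move=> IRxi avg _ _ /morphimP[x nUx Vx ->] /morphimP[r nUr Rr ->].
  have nVr : r \in 'N(V) := subsetP nVR r Rr.
  apply: nUinj; rewrite -morphJ //= !avg ?memJ_norm //.
  rewrite (reindex_inj (conjg_inj r)) /=.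
  apply: eq_big => [u|u Uu]; first by rewrite memJ_norm.
  by rewrite -conjMg !cfunE !inertia_valJ ?(subsetP IRm) ?(subsetP IRxi).
have pRU: p.-group (R / U)%g by apply: quotient_pgroup.
have actR: [acts (R / U)%g, on (V / U)%g | 'J].
  by rewrite astabsJ quotient_norms.
have Apsi (psi : 'CF(V / U)) : psi \is a character ->
    {in (V / U)%g, forall x, psi x \in Aint}.
  by move=> Npsi x _; apply: Aint_char.
have := sum_afix_mod pRU actR (Apsi _ Npsi1) (inv_psi _ _ IRm avg1).
have := sum_afix_mod pRU actR (Apsi _ Npsi2) (inv_psi _ _ IRmz avg2).
have -> : \sum_(x in 'Fix_((V / U)%g | 'J)((R / U)%g)) psi2 x
        = \sum_(x in 'Fix_((V / U)%g | 'J)((R / U)%g)) psi1 x.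
  apply: eq_bigr => _ /setIP[/morphimP[y nUy Vy ->] /afixP cy].
  apply: nUinj; rewrite avg1 // avg2 //; apply: eq_bigr => u Uu.
  rewrite !cfunE fix_coset // => r Rr.
  have nUr : r \in 'N(U) := subsetP nUR r Rr.
  rewrite coset_idr ?groupR // morphR //; apply/eqP/conjg_fixP.
  by apply: cy; rewrite mem_quotient.
rewrite psi2_0 psi1_1 eqAmod_sym => fix0 /eqAmod_trans/(_ fix0).
by rewrite eqAmod0_nat p'natE // negbK.
Qed.

End RelativeInvariance.

(** * Invariant characters of coprime sections *)

Section CoprimeAction.

Local Open Scope group_scope.

Variables (gT : finGroupType) (p : nat).
Implicit Types (G H U P Q R Y : {group gT}) (x y z : gT).
Hypothesis p_pr : prime p.

(** Count the pairs (y, g) with y ^ g in H: there are #|H| of them for each g,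
    at least #|H| for each y, and #|Y| for y = 1. *)
Lemma cover_conj_sub Y H :
    H \subset Y -> (forall y, y \in Y -> exists2 g, g \in Y & y ^ g \in H) ->
  Y \subset H.
Proof.
move=> sHY covH; pose N y := (\sum_(g in Y) ((y ^ g)%g \in H))%N.
have sumN : (\sum_(y in Y) N y = #|Y| * #|H|)%N.
  rewrite exchange_big /= -sum_nat_const; apply: eq_bigr => g Yg.
  rewrite -(cardJg H g^-1) -sum1_card big_mkcond [RHS]big_mkcond /=.
  apply: eq_bigr => y _; rewrite mem_conjgV.
  case: ifP => Yy; case: ifP => // Hyg.
  by have := subsetP sHY _ Hyg; rewrite memJ_norm ?(subsetP (normG Y)) ?Yy.
have leN y : y \in Y -> (#|H| <= N y)%N.
  case/covH=> g0 Yg0 Hyg0; rewrite -(card_lcoset H g0) -sum1_card.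
  rewrite big_mkcond /N [leqRHS]big_mkcond; apply: leq_sum => g _.
  case: ifP => // /lcosetP[h Hh ->].
  by rewrite conjgM (groupJ Hyg0 Hh) (groupM Yg0 (subsetP sHY h Hh)).
have [//|nsYH] := boolP (Y \subset H).
have: (#|Y| * #|H| < \sum_(y in Y) N y)%N; last by rewrite sumN ltnn.
rewrite -sum_nat_const (bigD1 1) //= [X in (_ < X)%N](bigD1 1) //=.
rewrite -addSn leq_add //; last by apply: leq_sum => y /andP[Yy _]; apply: leN.
have -> : N 1 = #|Y|.
  by rewrite /N -sum1_card; apply: eq_bigr => g _; rewrite conj1g group1.
by rewrite proper_card // properE sHY.
Qed.

(** Column orthogonality modulo p shows that z preserves the conjugacy class
    in U of every x centralized by Q: only the Q-invariant irreducible characters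
    count in the sum over 'chi_i of 'chi_i x times the conjugate of
    'chi_i (x ^ z), and they are z-invariant. *)
Lemma class_fix_inertia U Q z x :
    p.-group Q -> Q \subset 'N(U) -> p^'.-group U -> z \in 'N(U) -> z \in 'N(Q) ->
    (forall i : Iirr U, Q \subset 'I['chi_i] -> ('chi_i ^ z)%CF = 'chi_i) ->
  x \in 'C_U(Q) -> x ^ z \in x ^: U.
Proof.
move=> pQ nUQ p'U nUz nQz fixz /setIP[Ux cQx].
have Uxz : x ^ z \in U by rewrite memJ_norm.
have cQxz : x ^ z \in 'C(Q).
  by rewrite -(normP nQz) centJ memJ_conjg.
have actP: is_action 'N(U) (@conjg_Iirr _ U).
  split=> [y j k eq_jk | j y w Ny Nw].
    by apply/irr_inj/(can_inj (cfConjgK y)); rewrite -!conjg_IirrE eq_jk.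
  by apply: irr_inj; rewrite !conjg_IirrE cfConjgMnorm.
pose to := Action actP.
have actQ: [acts Q, on [set: Iirr U] | to].
  apply/subsetP=> q Qq; apply/setIP; split; first exact: (subsetP nUQ).
  by rewrite inE; apply/subsetP=> i; rewrite !inE.
have inv_val (y : gT) i q : q \in Q -> y \in 'C(Q) -> 'chi_(to i q) y = 'chi[U]_i y.
  move=> Qq cQy; rewrite /= conjg_IirrE cfConjgE ?(subsetP nUQ) //.
  by congr ('chi_i _); apply/conjg_fixP/commgP/(centP cQy); rewrite groupV.
pose f y (i : Iirr U) : algC := ('chi_i x * ('chi_i y)^*)%R.
have fA y : {in [set: Iirr U], forall i, f y i \in Aint}.
  by move=> i _; rewrite rpredM ?Aint_aut ?Aint_irr.
have finv y : y \in 'C(Q) -> {in [set: Iirr U] & Q, forall i q, f y (to i q) = f y i}.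
  by move=> cQy i q _ Qq; rewrite /f !inv_val.
have := sum_afix_mod pQ actQ (fA x) (finv _ cQx).
have := sum_afix_mod pQ actQ (fA (x ^ z)) (finv _ cQxz).
have -> : (\sum_(i in 'Fix_([set: Iirr U] | to)(Q)) f (x ^ z)%g i
        = \sum_(i in 'Fix_([set: Iirr U] | to)(Q)) f x i)%R.
  apply: eq_bigr => i /setIP[_ /afixP fix_i]; congr (_ * _^*)%R.
  rewrite -[in LHS](fixz i) ?cfConjgEJ //.
  apply/subsetP=> q Qq; rewrite inE (subsetP nUQ) //=.
  by rewrite -conjg_IirrE; apply/eqP; congr ('chi__); apply: fix_i.
rewrite ![(\sum_(i in [set: _]) _)%R](eq_bigl predT) => [|i|i]; rewrite ?inE //.
rewrite /f !second_orthogonality_relation // class_refl mulr1n.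
case: (boolP (x ^ z \in x ^: U)) => // notUxz.
rewrite class_sym (negPf notUxz) mulr0n eqAmod_sym => fix0 /eqAmod_trans/(_ fix0).
rewrite eqAmod0_nat => p_dvd; have := p'U; rewrite /pgroup p'natE //.
by rewrite (dvdn_trans p_dvd) // cardSg ?subsetIl.
Qed.

(** Elements of 'C_U(Q) that are conjugate in U are conjugate in 'C_U(Q), by
    Sylow's theorem in the centralizer of one of them. So z preserves the classes
    of the p'-group 'C_U(Q), and each of them contains a fixed point of z. *)
Lemma cent_fix_inertia U Q z :
    p.-group Q -> Q \subset 'N(U) -> p^'.-group U ->
    p.-elt z -> z \in 'N(U) -> z \in 'N(Q) ->
    (forall i : Iirr U, Q \subset 'I['chi_i] -> ('chi_i ^ z)%CF = 'chi_i) ->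
  'C_U(Q) \subset 'C[z].
Proof.
move=> pQ nUQ p'U p_z nUz nQz fixz; set Y := 'C_U(Q).
have nYz : z \in 'N(Y).
  by rewrite -sub1set normsI ?norms_cent ?sub1set.
have tiUQ : U :&: Q = 1 by apply: coprime_TIg; rewrite coprime_sym (pnat_coprime pQ).
have fusion x u : x \in Y -> u \in U -> x ^ u \in Y -> x ^ u \in x ^: Y.
  move=> Yx Uu Yxu; have [Ux cQx] := setIP Yx; have [Uxu cQxu] := setIP Yxu.
  pose W := (U <*> Q)%G; pose C := 'C_W[x ^ u]%G.
  have oW : #|W| = (#|U| * #|Q|)%N by rewrite /= norm_joinEr // TI_cardMg.
  have sylQ : p.-Sylow(W) Q.
    rewrite pHallE joing_subr oW partnM ?cardG_gt0 // part_p'nat // mul1n.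
    by rewrite part_pnat_id ?eqxx.
  have sQC : Q \subset C by rewrite subsetI joing_subr sub_cent1.
  have sUW : U \subset W by apply: joing_subl.
  have Wu : u \in W by apply: (subsetP sUW).
  have sQuC : Q :^ u \subset C.
    rewrite subsetI -{1}(conjGid Wu) conjSg joing_subr /=.
    by rewrite sub_cent1 centJ memJ_conjg.
  have sCW : C \subset W by apply: subsetIl.
  have sylQC := pHall_subl sQC sCW sylQ.
  have sylQuC : p.-Sylow(C) (Q :^ u).
    by apply: pHall_subl sQuC sCW _; rewrite pHallJ.
  have [c Cc defQu] := Sylow_trans sylQC sylQuC.
  have : c \in Q * 'C_U[x ^ u].
    have : C \subset Q * (U :&: C).
      by rewrite group_modl // subsetI subxx andbT normC // -norm_joinEr.
    by move/subsetP/(_ c Cc); rewrite setIA (setIidPl sUW).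
  case/imset2P=> q v Qq /setIP[Uv cv] defc.
  pose w := u * v^-1.
  have nQw : w \in 'N(Q).
    by apply/normP; rewrite conjsgM defQu defc conjsgM (conjGid Qq) conjsgK.
  have Uw : w \in U by rewrite groupM ?groupV.
  have Yw : w \in Y.
    rewrite inE Uw /=; apply/centP=> r Qr; apply/commgP.
    rewrite -in_set1 -[[set 1]]tiUQ inE.
    rewrite {1}commgEl {1}commgEr groupM ?groupV ?memJ_norm ?groupV ?(subsetP nUQ) //=.
    by rewrite groupM // ?groupV ?memJ_norm ?groupV.
  have -> : x ^ u = x ^ w.
    rewrite conjgM; apply/esym/conjg_fixP/commgP.
    by apply: commuteV; apply: commute_sym; apply/cent1P.
  exact: imset_f.
have clY x : x \in Y -> x ^ z \in x ^: Y.
  move=> Yx; have := class_fix_inertia pQ nUQ p'U nUz nQz fixz Yx.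
  case/imsetP=> u Uu def_xz; rewrite def_xz fusion // -def_xz.
  by rewrite memJ_norm.
have p'Y : p^'.-group Y by apply: pgroupS p'U; apply: subsetIl.
suffices: Y \subset 'C_Y[z] by rewrite subsetI => /andP[].
apply: cover_conj_sub; first exact: subsetIl.
move=> x Yx.
have actz : [acts <[z]>, on x ^: Y | 'J].
  rewrite astabsJ cycle_subG inE; apply/subsetP=> _ /imsetP[_ /imsetP[v Yv ->] ->].
  have /imsetP[w Yw defxz] := clY x Yx.
  by rewrite conjJg defxz -conjgM imset_f // groupM ?memJ_norm.
have := pgroup_fix_mod p_z actz.
have [-> | /set0Pn[y /setIP[/imsetP[v Yv ->] /afixP fixy]] _] :=
  eqVneq ('Fix_(x ^: Y | 'J)(<[z]>)) set0.
  rewrite cards0 => /eqP; rewrite mod0n -/(dvdn _ _) => p_dvd.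
  have : p^'.-nat #|x ^: Y| by apply: pnat_dvd p'Y; rewrite -index_cent1 dvdn_indexg.
  by rewrite p'natE // p_dvd.
exists v => //; rewrite inE memJ_norm ?(subsetP (normG Y)) // Yx.
by apply/cent1P/commgP/conjg_fixP; apply: fixy; apply: cycle_id.
Qed.

(** R can be enlarged by elements of its normalizer in P one at a time, because
    the characters that it fixes are fixed by all of P. *)
Lemma cent_inertia_sub U P R :
    p.-group P -> P \subset 'N(U) -> p^'.-group U -> R \subset P ->
    (forall i : Iirr U, R \subset 'I['chi_i] -> P \subset 'I['chi_i]) ->
  'C_U(R) \subset 'C(P).
Proof.
move=> pP nUP p'U sRP RP_inv.
pose gP (Q : {group gT}) := [&& R \subset Q, Q \subset P & 'C_U(R) \subset 'C(Q)].
have gR : gP R by rewrite /gP subxx sRP subsetIr.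
have [Q /maxgroupP[/and3P[sRQ sQP cQ] maxQ] _] := @maxgroup_exists _ gP _ gR.
have [<- // | neqQP] := eqVneq Q P.
have ltQP : Q \proper P by rewrite properEneq neqQP.
have /properP[_ [z /setIP[Pz nQz] Q'z]] := nilpotent_proper_norm (pgroup_nil pP) ltQP.
have pQ := pgroupS sQP pP; have p_z := mem_p_elt pP Pz.
have nUz : z \in 'N(U) := subsetP nUP z Pz.
have cz : 'C_U(Q) \subset 'C[z].
  apply: cent_fix_inertia => //; first exact: subset_trans sQP nUP.
  move=> i IQi; apply: inertiaJ; apply: (subsetP (RP_inv i _) z Pz).
  exact: subset_trans sRQ IQi.
have gQz : gP (Q <*> <[z]>)%G.
  rewrite /gP (subset_trans sRQ) ?joing_subl // join_subG sQP cycle_subG Pz /=.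
  rewrite centY subsetI cQ cent_cycle (subset_trans _ cz) //.
  by rewrite subsetI subsetIl cQ.
case/negP: Q'z; rewrite -(maxQ _ gQz) ?joing_subl //.
by rewrite (subsetP (joing_subr _ _)) ?cycle_id.
Qed.

End CoprimeAction.

(** * Distinct Sylow subgroups and degrees *)

Lemma deg_Clifford (gT : finGroupType) (G U : {group gT}) (i : Iirr U) (j : Iirr G) :
    U <| G -> i \in irr_constt ('Res[U] 'chi_j) ->
  exists2 e, '['Res[U] 'chi_j, 'chi_i] = e%:R
           & deg j = (e * (#|G : 'I_G['chi_i]| * deg i))%N.
Proof.
move=> nsUG sij; have [sUG _] := andP nsUG.
have /natrP[e def_e] : '['Res[U] 'chi_j, 'chi_i] \in Num.nat.
  by rewrite Cnat_cfdot_char_irr ?cfRes_char ?irr_char.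
exists e => //; apply/eqP; rewrite -eqC_nat -degE -(cfRes1 U).
rewrite (Clifford_Res_sum_cfclass nsUG sij) def_e cfunE !natrM; apply/eqP.
congr (_ * _); rewrite sum_cfunE -degE -size_cfclass.
rewrite big_seq_cond (eq_bigr (fun _ => 'chi_i 1%g)); last first.
  by move=> _ /andP[/cfclassP[y _ ->] _]; rewrite cfConjg1.
by rewrite -big_seq_cond big_const_seq count_predT iter_addr_0 mulr_natl.
Qed.

Lemma index_inertia_dvd_deg (gT : finGroupType) (G U : {group gT})
    (i : Iirr U) (j : Iirr G) :
    U <| G -> i \in irr_constt ('Res[U] 'chi_j) ->
  (#|G : 'I_G['chi_i]| %| deg j)%N.
Proof.
by move=> nsUG sij; have [e _ ->] := deg_Clifford nsUG sij; rewrite dvdn_mull ?dvdn_mulr.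
Qed.

Lemma deg_constt_dvd (gT : finGroupType) (G U : {group gT})
    (i : Iirr U) (j : Iirr G) :
    U <| G -> i \in irr_constt ('Res[U] 'chi_j) -> (deg i %| deg j)%N.
Proof.
by move=> nsUG sij; have [e _ ->] := deg_Clifford nsUG sij; rewrite !dvdn_mull.
Qed.

Lemma deg_mod (gT : finGroupType) (G N : {group gT}) (i : Iirr (G / N)) :
  N <| G -> deg (mod_Iirr i) = deg i.
Proof. by move=> nsNG; apply: deg_irr_eq; rewrite mod_IirrE // cfMod1. Qed.

Lemma pSylow_superset_index (gT : finGroupType) (p : nat) (G T R : {group gT}) :
    R \subset T -> T \subset G -> p.-group R -> p^'.-nat #|G : T| ->
  exists2 P : {group gT}, p.-Sylow(G) P & (R \subset P) && (P \subset T).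
Proof.
move=> sRT sTG pR p'GT; have [P sylP sRP] := Sylow_superset sRT pR.
exists P; last by rewrite sRP (pHall_sub sylP).
rewrite pHallE (subset_trans (pHall_sub sylP)) //= (card_Hall sylP).
by rewrite -(Lagrange sTG) partnM ?cardG_gt0 // (part_p'nat p'GT) muln1.
Qed.

Section SylowPairs.

Variable p : nat.
Hypothesis p_pr : prime p.

(** By coprimeness chi_i extends to U * R, whose index has p-part #|P : R|; the
    character of G induced by the extension has a constituent of no larger
    p-part. *)
Lemma small_deg_over_p'normal (gT : finGroupType) (G U P R : {group gT}) (i : Iirr U) :
    U <| G -> p^'.-group U -> p.-Sylow(G) P -> R \subset P -> R \subset 'I['chi_i] ->
  exists2 j : Iirr G, i \in irr_constt ('Res[U] 'chi_j)
                    & ((deg j)`_p <= #|P : R|)%N.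
Proof.
move=> nsUG p'U sylP sRP IRi; have [sUG nUG] := andP nsUG.
have [sPG pP _] := and3P sylP; have pR := pgroupS sRP pP.
have sRG := subset_trans sRP sPG; have nUR := subset_trans sRG nUG.
pose W := (U <*> R)%G.
have sWG: W \subset G by rewrite join_subG sUG.
have nsUW: U <| W by apply: normalS nsUG; rewrite ?joing_subl.
have quoW: (W / U = R / U)%g by rewrite /= norm_joinEr // quotientMidl.
have pWU: p.-nat #|W : U|.
  by rewrite -card_quotient ?normal_norm // quoW; apply: quotient_pgroup.
have IWi: W \subset 'I['chi_i] by rewrite join_subG sub_inertia.
have solWU: solvable (W / U) by rewrite quoW quotient_sol ?(pgroup_sol pR).
have co_i: coprime #|W : U| ('o('chi_i)%CF * deg i).
  apply: pnat_coprime pWU _; rewrite pnatM; apply/andP; split.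
    apply: pnat_dvd p'U; apply: cforder_lin_char_dvdG; exact: cfDet_lin_char.
  exact: pnat_dvd (deg_dvd_card i) p'U.
have [c [def_c _ _]] := extend_solvable_coprime_irr nsUW solWU IWi co_i.
have NInd: 'Ind[G] 'chi_c \is a character by rewrite cfInd_char ?irr_char.
have Ind1: 'Ind[G] 'chi_c 1%g = (#|G : W| * deg c)%:R by rewrite cfInd1 // degE natrM.
have Ind_gt0: (0 < #|G : W| * deg c)%N by rewrite muln_gt0 indexg_gt0 deg_gt0.
have [j sj le_j] := small_constituent p_pr NInd Ind1 Ind_gt0.
exists j.
  have NRj: 'Res[W] 'chi_j \is a character by rewrite cfRes_char ?irr_char.
  have: i \in irr_constt ('Res[U] 'chi_c) by rewrite def_c constt_irr inE.
  rewrite constt_Ind_Res in sj => /(constt_Res_trans NRj sj).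
  by rewrite cfResRes ?joing_subl.
apply: leq_trans le_j _; rewrite partnM ?indexg_gt0 ?deg_gt0 //.
have -> : deg c = deg i by apply: deg_irr_eq; rewrite -def_c cfRes1.
rewrite (part_p'nat (pnat_dvd (deg_dvd_card i) p'U)) muln1.
have sylRW: p.-Sylow(W) R.
  have tiUR : U :&: R = 1%g.
    by apply: coprime_TIg; rewrite coprime_sym (pnat_coprime pR).
  rewrite pHallE joing_subr /= norm_joinEr // TI_cardMg //.
  by rewrite partnM ?cardG_gt0 // (part_p'nat p'U) mul1n part_pnat_id ?eqxx.
have := Lagrange sWG => /(congr1 (fun n => n`_p)%N).
rewrite partnM ?cardG_gt0 // -(card_Hall sylRW) -(card_Hall sylP).
by rewrite -(Lagrange sRP) => /eqP; rewrite eqn_pmul2l ?cardG_gt0 // => /eqP->.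
Qed.

(** Two distinct Sylow subgroups P and Q already force a character of degree
    divisible by p, with p-part at most #|P : R| when R lies in both. Where P and
    Q become equal modulo a normal p'-subgroup U, the element u of U that
    conjugates P into Q centralizes R but not P, so U has an R-invariant
    character that P moves; if no character over it will do, it is fixed by a Sylow
    subgroup containing R, which still differs from P modulo U. *)
Lemma Sylow_pair_deg (gT : finGroupType) (G P Q R : {group gT}) :
    psolv p G -> p.-Sylow(G) P -> p.-Sylow(G) Q -> R \subset P -> R \subset Q ->
    P :!=: Q ->
  exists2 j : Iirr G, (p %| deg j)%N & ((deg j)`_p <= #|P : R|)%N.
Proof.
have [n] := ubnP #|G|; elim: n gT G P Q R => // n IHn gT G P Q R.
move=> /ltnSE-leGn solG sylP sylQ sRP sRQ neqPQ.
have [sPG pP _] := and3P sylP; have [sQG pQ _] := and3P sylQ.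
have ntG: 1%G \proper G.
  rewrite properE sub1G; apply: contra neqPQ => sG1.
  have trivS (X : {group gT}) : X \subset G -> X :=: 1%g.
    by move=> sXG; apply/trivgP; apply: subset_trans sXG sG1.
  by apply/eqP; exact: etrans (trivS P sPG) (esym (trivS Q sQG)).
have [U [nsUG /proper_neq ntU _ pfacU]] := solG _ _ (normal1 G) (normal_refl G) ntG.
have {ntU}ntU : U :!=: 1%g by rewrite eq_sym.
rewrite indexg1 in pfacU; have [sUG nUG] := andP nsUG.
have IHU (Q1 : {group gT}) : p.-Sylow(G) Q1 -> R \subset Q1 -> (P / U != Q1 / U)%g ->
  exists2 j : Iirr G, (p %| deg j)%N & ((deg j)`_p <= #|P : R|)%N.
- move=> sylQ1 sRQ1 neqPQ1; have [sQ1G _ _] := and3P sylQ1.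
  have [|||||||j p_j le_j] := IHn _ (G / U)%G (P / U)%G (Q1 / U)%G (R / U)%G.
  - by rewrite (leq_trans _ leGn) // ltn_quotient.
  - exact: psolv_quotient.
  - by apply: quotient_pHall => //; apply: subset_trans nUG.
  - by apply: quotient_pHall => //; apply: subset_trans nUG.
  - exact: quotientS.
  - exact: quotientS.
  - by [].
  exists (mod_Iirr j); rewrite deg_mod //; apply: leq_trans le_j _.
  apply: dvdn_leq; rewrite ?indexg_gt0 // index_quotient //.
  by rewrite subIset // (subset_trans sPG nUG).
have [nUP nUQ] := (subset_trans sPG nUG, subset_trans sQG nUG).
case/orP: pfacU => [pU | p'U].
  have sUS (X : {group gT}) : p.-Sylow(G) X -> U \subset X.
    move=> sylX; apply: subset_trans (pcore_sub_Hall sylX).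
    exact: pcore_max.
  apply: (IHU _ sylQ sRQ); apply: contra neqPQ => /eqP eqPQ; apply/eqP.
  have nsUP : U <| P by rewrite /normal (sUS _ sylP) nUP.
  have nsUQ : U <| Q by rewrite /normal (sUS _ sylQ) nUQ.
  exact: quotient_inj nsUP nsUQ eqPQ.
have [eqPQ | ] := eqVneq (P / U)%g (Q / U)%g; last exact: IHU.
have tiPU : P :&: U = 1%g by apply: coprime_TIg; apply: pnat_coprime pP p'U.
have [u Uu defQ] : exists2 u, u \in U & Q :=: (P :^ u)%g.
  pose W := (U <*> P)%G.
  have sWG: W \subset G by rewrite join_subG sUG.
  have sQW: Q \subset W.
    by rewrite /= norm_joinEr // -quotientSK // eqPQ.
  have sylPW := pHall_subl (joing_subr U P) sWG sylP.
  have sylQW := pHall_subl sQW sWG sylQ.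
  have [w Ww ->] := Sylow_trans sylPW sylQW.
  have: w \in (P * U)%g by rewrite normC // -norm_joinEr.
  case/imset2P=> v u Pv Uu ->; exists u => //.
  by rewrite conjsgM conjGid.
have cRu : u \in 'C_U(R).
  rewrite inE Uu /=; apply/centP=> r Rr.
  have: r \in (P :^ u)%g by rewrite -defQ (subsetP sRQ).
  case/imsetP=> s Ps def_r.
  have rs : r = s.
    apply/eqP; rewrite eq_mulVg1 -in_set1 -[[set 1%g]]tiPU inE; apply/andP; split.
      by rewrite groupM ?groupV // (subsetP sRP).
    rewrite def_r -conjVg -commgEr commgEl groupM ?groupV //.
    by rewrite memJ_norm // (subsetP nUP).
  by apply/esym/commgP/conjg_fixP; rewrite {1}rs -def_r.
have ncPu : u \notin 'C(P).
  apply: contra neqPQ => cPu; rewrite defQ eq_sym; apply/eqP.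
  by apply/normP; apply: (subsetP (cent_sub P)).
have /existsP[i /andP[IRi nIPi]] :
    [exists i : Iirr U, (R \subset 'I['chi_i]) && ~~ (P \subset 'I['chi_i])].
  apply: contraR ncPu; rewrite negb_exists => /forallP invP.
  apply: (subsetP (cent_inertia_sub p_pr pP nUP p'U sRP _)) cRu => i IRi.
  by have := invP i; rewrite IRi negbK.
have [j sij le_j] := small_deg_over_p'normal nsUG p'U sylP sRP IRi.
have [p_j | p'j] := boolP (p %| deg j)%N; first by exists j.
have p'GI : p^'.-nat #|G : 'I_G['chi_i]|.
  rewrite p'natE //; apply: contra p'j => p_i.
  exact: dvdn_trans p_i (index_inertia_dvd_deg nsUG sij).
have sRI : R \subset 'I_G['chi_i] by rewrite subsetI (subset_trans sRP).
have [Q1 sylQ1 /andP[sRQ1 sQ1I]] :=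
  pSylow_superset_index sRI (Inertia_sub _ _) (pgroupS sRP pP) p'GI.
apply: IHU sylQ1 sRQ1 _; apply: contra nIPi => /eqP eqPQ1.
have: P \subset (U * Q1)%g by rewrite -quotientSK // eqPQ1.
move/subset_trans; apply; rewrite mul_subG ?sub_inertia //.
exact: subset_trans sQ1I (subsetIr _ _).
Qed.

End SylowPairs.

(** * From a Sylow subgroup to the group *)

Lemma Res_invariant_irr (gT : finGroupType) (G U : {group gT})
    (i : Iirr U) (j : Iirr G) :
    U <| G -> G \subset 'I['chi_i] -> i \in irr_constt ('Res[U] 'chi_j) ->
  exists2 e, deg j = (e * deg i)%N & 'Res[U] 'chi_j = e%:R *: 'chi_i.
Proof.
move=> nsUG IGi sij; have [e def_e def_j] := deg_Clifford nsUG sij; exists e.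
  by rewrite def_j (setIidPl IGi) indexgg mul1n.
rewrite (Clifford_Res_sum_cfclass nsUG sij) def_e.
by rewrite cfclass_invariant // big_seq1.
Qed.

Lemma irr_quotient_isom (gT : finGroupType) (P U : {group gT}) (s : Iirr P) :
  P \subset 'N(U) -> U :&: P = 1%g -> exists t : Iirr (P / U), deg t = deg s.
Proof.
move=> nUP tiUP; exists (isom_Iirr (quotient_isom nUP tiUP) s).
by apply: deg_irr_eq; rewrite isom_IirrE cfIsom1.
Qed.

Section SylowToGroup.

Variable p : nat.
Hypothesis p_pr : prime p.

(** The multiplicity of chi_l in chi_j is prime to p, so chi_j has a constituent
    on P whose restriction to U is a multiple of chi_l prime to p; that multiple is
    the degree of the constituent, which is a power of p, so it is 1. *)
Lemma linear_extension_of_p'deg (gT : finGroupType) (G P U : {group gT})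
    (l : Iirr U) (j : Iirr G) :
    U <| G -> U \subset P -> P \subset G -> p.-group P ->
    P \subset 'I['chi_l] -> 'chi_l \is a linear_char ->
    l \in irr_constt ('Res[U] 'chi_j) -> ~~ (p %| deg j)%N ->
  exists2 v : Iirr P, 'chi_v \is a linear_char & 'Res[U] 'chi_v = 'chi_l.
Proof.
move=> nsUG sUP sPG pP IPl lin_l slj p'j.
have nsUP : U <| P by apply: normalS nsUG.
have [e def_e def_j] := deg_Clifford nsUG slj.
have p'e : ~~ (p %| e)%N by apply: contra p'j => pe; rewrite def_j dvdn_mulr.
have NRj : 'Res[P] 'chi_j \is a character by rewrite cfRes_char ?irr_char.
have /existsP[v /andP[sv p'v]] : [exists v, (v \in irr_constt ('Res[P] 'chi_j))
    && ~~ (p %| Num.truncn '['Res[U] 'chi_v, 'chi_l])%N].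
  apply: contraR p'e; rewrite negb_exists => /forallP no_v.
  suffices: (p %| '['Res[U] 'chi_j, 'chi_l])%C by rewrite def_e dvdC_nat.
  rewrite -(cfResRes _ sUP sPG).
  rewrite {1}(cfun_sum_constt ('Res[P] 'chi_j)) linear_sum cfdot_suml.
  apply: rpred_sum => v sv; rewrite linearZ /= cfdotZl.
  have /natrP[m ->] := Cnat_cfdot_char_irr v NRj.
  have NRv : 'Res[U] 'chi_v \is a character by rewrite cfRes_char ?irr_char.
  have := no_v v; rewrite sv negbK /=.
  have /natrP[k ->] := Cnat_cfdot_char_irr l NRv; rewrite natrK => p_k.
  by rewrite -natrM dvdC_nat dvdn_mull.
have svl : l \in irr_constt ('Res[U] 'chi_v).
  by rewrite irr_consttE; apply: contraNneq p'v => ->; rewrite truncn0 dvdn0.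
have [f def_v Rv] := Res_invariant_irr nsUP IPl svl.
rewrite (deg_lin lin_l) muln1 in def_v.
rewrite Rv cfdotZl cfnorm_irr mulr1 natrK in p'v.
have f1 : f = 1%N.
  have := natdeg_pgroup v pP; rewrite def_v => /p_natP[[|k] def_f] //.
  by case/negP: p'v; rewrite def_f expnS dvdn_mulr.
by exists v; rewrite -?deg_eq1 ?def_v ?f1 // Rv f1 scale1r.
Qed.

(** Normal p'-subgroups of G can be factored out. Otherwise let U be a nontrivial
    normal p-subgroup and lambda a constituent of the restriction of chi_s to U.
    The character induced by chi_s has a constituent of small p-part, which lies
    over lambda. If its degree is prime to p, then lambda is linear and its
    stabilizer contains a Sylow subgroup. Either P does not fix lambda, and
    Sylow_pair_deg applies to P and a Sylow subgroup that contains the stabilizer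
    of lambda in P; or lambda extends to P, and after multiplication by a linear
    character chi_s becomes a character of P / U. *)
Theorem exists_small_deg (gT : finGroupType) (G P : {group gT}) (s : Iirr P) :
    psolv p G -> p.-Sylow(G) P -> (1 < deg s)%N ->
  exists2 j : Iirr G, (p %| deg j)%N & ((deg j)`_p <= deg s)%N.
Proof.
have [n] := ubnP #|G|; elim: n gT G P s => // n IHn gT G P s.
move=> /ltnSE-leGn solG sylP s_gt1; have [sPG pP _] := and3P sylP.
have ntP : P :!=: 1%g.
  apply: contraTneq s_gt1 => P1; have := deg_dvd_card s.
  by rewrite P1 cards1 dvdn1 => /eqP->.
have ntG: 1%G \proper G.
  by rewrite proper1G; apply: contraNneq ntP => G1; rewrite -subG1 -G1.
have [U [nsUG /proper_neq ntU _ pfacU]] := solG _ _ (normal1 G) (normal_refl G) ntG.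
have {ntU}ntU : U :!=: 1%g by rewrite eq_sym.
rewrite indexg1 in pfacU; have [sUG nUG] := andP nsUG.
have nUP := subset_trans sPG nUG.
have IHU (t : Iirr (P / U)) : deg t = deg s ->
  exists2 j : Iirr G, (p %| deg j)%N & ((deg j)`_p <= deg s)%N.
- move=> def_t; have [||||j p_j le_j] := IHn _ (G / U)%G (P / U)%G t.
  - by rewrite (leq_trans _ leGn) // ltn_quotient.
  - exact: psolv_quotient.
  - exact: quotient_pHall.
  - by rewrite def_t.
  by exists (mod_Iirr j); rewrite deg_mod // -def_t.
case/orP: pfacU => [pU | p'U]; last first.
  have tiUP : U :&: P = 1%g.
    by apply: coprime_TIg; rewrite coprime_sym (pnat_coprime pP).
  by have [t def_t] := irr_quotient_isom s nUP tiUP; apply: IHU def_t.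
have sUP : U \subset P.
  by apply: subset_trans (pcore_sub_Hall sylP); apply: pcore_max.
have nsUP : U <| P by apply: normalS nsUG.
have [l sl] : exists l, l \in irr_constt ('Res[U] 'chi_s).
  exact/neq0_has_constt/Res_irr_neq0.
have NInd : 'Ind[G] 'chi_s \is a character by rewrite cfInd_char ?irr_char.
have Ind1 : 'Ind[G] 'chi_s 1%g = (#|G : P| * deg s)%:R by rewrite cfInd1 // degE natrM.
have Ind_gt0 : (0 < #|G : P| * deg s)%N by rewrite muln_gt0 indexg_gt0 deg_gt0.
have [j sj le_j] := small_constituent p_pr NInd Ind1 Ind_gt0.
have {}le_j : ((deg j)`_p <= deg s)%N.
  apply: leq_trans le_j _; rewrite partnM ?indexg_gt0 ?deg_gt0 //.
  have p'GP : p^'.-nat #|G : P| by case/and3P: sylP.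
  by rewrite (part_p'nat p'GP) mul1n deg_pgroup.
have [p_j | p'j] := boolP (p %| deg j)%N; first by exists j.
have slj : l \in irr_constt ('Res[U] 'chi_j).
  have NRj : 'Res[P] 'chi_j \is a character by rewrite cfRes_char ?irr_char.
  rewrite constt_Ind_Res in sj; have := constt_Res_trans NRj sj sl.
  by rewrite cfResRes.
have lin_l : 'chi_l \is a linear_char.
  rewrite -deg_eq1; have := natdeg_pgroup l pU.
  have := contra (fun d => dvdn_trans d (deg_constt_dvd nsUG slj)) p'j.
  move=> p'l /p_natP[[|k] def_l]; first by rewrite def_l.
  by case/negP: p'l; rewrite def_l expnS dvdn_mulr.
have [IPl | nIPl] := boolP (P \subset 'I['chi_l]); last first.
  have p'GI : p^'.-nat #|G : 'I_G['chi_l]|.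
    rewrite p'natE //; apply: contra p'j => p_i.
    exact: dvdn_trans p_i (index_inertia_dvd_deg nsUG slj).
  pose R := ('I_P['chi_l])%G.
  have sRP : R \subset P by apply: subsetIl.
  have sRI : R \subset 'I_G['chi_l] by rewrite setSI.
  have [Q sylQ /andP[sRQ sQI]] :=
    pSylow_superset_index sRI (Inertia_sub _ _) (pgroupS sRP pP) p'GI.
  have neqPQ : P :!=: Q.
    apply: contraNneq nIPl => ->; apply: subset_trans sQI (subsetIr _ _).
  have [j1 p_j1 le_j1] := Sylow_pair_deg p_pr solG sylP sylQ sRP sRQ neqPQ.
  exists j1 => //; apply: leq_trans le_j1 _.
  apply: dvdn_leq; rewrite ?deg_gt0 //.
  exact: index_inertia_dvd_deg nsUP sl.
have [v lin_v Rv] := linear_extension_of_p'deg nsUG sUP sPG pP IPl lin_l slj p'j.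
have /irrP[t def_t] : ('chi_v)^*%CF * 'chi_s \in irr P.
  by rewrite mul_lin_irr ?cfConjC_lin_char ?mem_irr.
have kerU : U \subset cfker 'chi_t.
  have [e _ Rs] := Res_invariant_irr nsUP IPl sl.
  apply/subsetP=> x Ux; rewrite cfkerEirr inE -def_t !cfunE.
  rewrite -!(cfResE 'chi_s sUP) // -!(cfResE 'chi_v sUP) // Rv Rs !cfunE.
  rewrite (lin_char1 lin_l) rmorph1 mul1r mulr1 mulrCA [_^* * _]mulrC -normCK.
  by rewrite normC_lin_char // expr1n mulr1.
apply: (IHU (quo_Iirr U t)).
rewrite -(deg_mod (quo_Iirr U t)) // quo_IirrK //.
apply: deg_irr_eq; rewrite -def_t !cfunE (lin_char1 lin_v).
by rewrite rmorph1 mul1r.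
Qed.

End SylowToGroup.

(** * From the group to a Sylow subgroup *)

Lemma irr_inflate (gT : finGroupType) (P U : {group gT}) (K : {group coset_of U})
    (b : Iirr K) :
  K :=: (P / U)%g -> P \subset 'N(U) -> exists s : Iirr P, deg s = deg b.
Proof.
move=> eqK nUP; have {}eqK : K = (P / U)%G by apply: group_inj.
subst K; have /irrP[s def_s] : cfMorph 'chi_b \in irr P.
  by rewrite cfMorph_irr // mem_irr.
by exists s; apply: deg_irr_eq; rewrite -def_s cfMorph1.
Qed.

Section GroupToSylow.

Variable p : nat.
Hypothesis p_pr : prime p.

Lemma p'_index_setI (gT : finGroupType) (U V P : {group gT}) :
  U <| V -> p^'.-nat #|V : U| -> p.-group P -> P :&: V \subset U.
Proof.
move=> /andP[sUV nUV] p'VU pP.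
have pPV : p.-group (P :&: V) by apply: pgroupS pP; apply: subsetIl.
have nUPV : P :&: V \subset 'N(U) by apply: subset_trans nUV; apply: subsetIr.
rewrite -quotient_sub1 //; apply/trivgP/card1_trivg.
have p'1 : p^'.-group ((P :&: V) / U)%g.
  apply: (@pgroupS _ _ (V / U)%G); first by rewrite quotientS ?subsetIr.
  by rewrite /pgroup card_quotient.
by apply: (pnat_1 (quotient_pgroup U pPV) p'1).
Qed.

(** Let e be the multiplicity of chi_t in chi_m, which is prime to p. It is the
    inner product of the characters of W induced by chi_m and by the extension
    chi_c of chi_t, so chi_m has a multiplicity f prime to p in some irreducible
    character of W. As chi_m is invariant, f divides the index #|W : V|, a power
    of p, and f = 1. *)
Lemma extension_over_p'section (gT : finGroupType) (U V P W J : {group gT})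
    (t : Iirr U) (m : Iirr V) (c : Iirr J) :
    U <| W -> V <| W -> U \subset V -> p^'.-nat #|V : U| -> p.-group P ->
    W :=: (V * P)%g -> J :=: (U * P)%g -> P \subset 'N(U) ->
    V \subset 'I['chi_t] -> W \subset 'I['chi_m] -> 'Res[U] 'chi_c = 'chi_t ->
    t \in irr_constt ('Res[U] 'chi_m) -> ~~ (p %| deg m)%N ->
  exists b : Iirr W, 'Res[V] 'chi_b = 'chi_m.
Proof.
move=> nsUW nsVW sUV p'VU pP defW defJ nUP IVt IWm Rc tm p'm.
have sVW := normal_sub nsVW; have nsUV : U <| V := normalS sUV sVW nsUW.
have sPW : P \subset W by rewrite defW mulG_subr.
have sJW : J \subset W by rewrite defJ defW mulSg.
have sUJ : U \subset J by rewrite defJ mulG_subl.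
have tiJV : J :&: V = U.
  apply/eqP; rewrite eqEsubset subsetI sUJ sUV !andbT defJ -group_modl //.
  by rewrite mul_subG // (p'_index_setI nsUV p'VU pP).
have [e def_m Rm] := Res_invariant_irr nsUV IVt tm.
have p'e : ~~ (p %| e)%N by apply: contra p'm; rewrite def_m; apply: dvdn_mulr.
have eqidx : #|W : V| = #|J : U|.
  have defWJ : (V * J)%g = W by rewrite defJ mulgA (mulGSid sUV) defW.
  have := mul_cardG V J; rewrite defWJ setIC tiJV -(Lagrange sVW) -(Lagrange sUJ).
  rewrite mulnCA [in RHS]mulnC => /eqP.
  by rewrite !eqn_pmul2l ?cardG_gt0 // eq_sym => /eqP.
have sumU : \sum_(x in U) 'chi_t x * ('chi_t x)^* = #|U|%:R.
  have := cfnorm_irr t; rewrite cfdotE => /(canRL (mulKf _)) -> //.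
    by rewrite mulr1 invrK.
  by rewrite invr_eq0 neq0CG.
have dotInd : '['Ind[W] 'chi_m, 'Ind[W] 'chi_c] = e%:R.
  rewrite -cfdot_Res_l cfdotE (big_setID V) /= tiJV [X in _ + X]big1 ?addr0.
    rewrite (eq_bigr (fun x => #|W : V|%:R * (e%:R * ('chi_t x * ('chi_t x)^*)))).
      rewrite -!mulr_sumr sumU eqidx -(Lagrange sUJ) natrM.
      rewrite [X in _ * X]mulrCA [X in _ * X]mulrC [_ * #|U|%:R]mulrC mulKf //.
      by rewrite mulf_neq0 ?pnatr_eq0 -?lt0n ?cardG_gt0.
    move=> x Ux; have Vx := subsetP sUV x Ux; have Jx := subsetP sUJ x Ux.
    have -> : 'chi_c x = 'chi_t x by rewrite -Rc cfResE.
    rewrite cfResE // -(cfResE _ sVW Vx) cfRes_Ind_invariant // cfunE.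
    by rewrite -(cfResE _ sUV Ux) Rm cfunE -!mulrA.
  move=> x /setDP[Jx V'x]; rewrite cfResE //.
  by rewrite (cfun_on0 (cfInd_normal _ nsVW) V'x) mul0r.
have NmR b : '['chi_m, 'Res[V] 'chi[W]_b] \in Num.nat.
  by rewrite Cnat_cfdot_char ?cfRes_char ?irr_char.
have /existsP[b p'b] : [exists b, ~~ (p %| Num.truncn '['chi_m, 'Res[V] 'chi[W]_b])%N].
  apply: contraR p'e; rewrite negb_exists => /forallP p_all.
  suffices: (p %| '['Ind[W] 'chi_m, 'Ind[W] 'chi_c])%C by rewrite dotInd dvdC_nat.
  rewrite cfdot_sum_irr rpred_sum // => b _.
  have pb: (p %| '['Ind[W] 'chi_m, 'chi_b])%C.
    by rewrite -cfdot_Res_r -(truncnK (NmR b)) dvdC_nat; apply/negPn/p_all.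
  have Nb: '['Ind[W] 'chi_c, 'chi_b] \in Num.nat.
    by rewrite Cnat_cfdot_char ?cfInd_char ?irr_char.
  by rewrite conj_natr // dvdC_mulr // intr_nat.
have mb : m \in irr_constt ('Res[V] 'chi_b).
  rewrite irr_consttE cfdotC conj_natr //; apply: contraNneq p'b => ->.
  by rewrite truncn0 dvdn0.
have [f def_b Rb] := Res_invariant_irr nsVW IWm mb.
have [f' def_b' dv_f'] := invariant_deg_ratio nsVW IWm mb.
have def_f : f = f'.
  by apply/eqP; rewrite -(eqn_pmul2r (deg_gt0 m)) -def_b -def_b'.
have p'f : ~~ (p %| f)%N.
  by move: p'b; rewrite Rb cfdotZr cfnorm_irr mulr1 conjC_nat natrK.
have pWV : p.-nat #|W : V|.
  rewrite eqidx -card_quotient ?(subset_trans sJW) ?normal_norm //.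
  by rewrite defJ quotientMidl; apply: quotient_pgroup.
have f1 : f = 1%N.
  apply: (@pnat_1 p); first by apply: pnat_dvd pWV; rewrite def_f.
  by rewrite p'natE // in p'f *.
by exists b; rewrite Rb f1 scale1r.
Qed.


Lemma constt_Res_invariant (gT : finGroupType) (G U V : {group gT})
    (t : Iirr U) (m : Iirr V) (j : Iirr G) :
    U <| G -> U \subset V -> V \subset G -> G \subset 'I['chi_t] ->
    t \in irr_constt ('Res[U] 'chi_j) -> m \in irr_constt ('Res[V] 'chi_j) ->
  t \in irr_constt ('Res[U] 'chi_m).
Proof.
move=> nsUG sUV sVG IGt tj mj.
have [l lm] : exists l, l \in irr_constt ('Res[U] 'chi_m).
  exact/neq0_has_constt/Res_irr_neq0.
have NRj : 'Res[V] 'chi_j \is a character by rewrite cfRes_char ?irr_char.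
have := constt_Res_trans NRj mj lm; rewrite cfResRes //.
have [e _ ->] := Res_invariant_irr nsUG IGt tj.
rewrite irr_consttE cfdotZl cfdot_irr; have [-> // | _] := eqVneq t l.
by rewrite mulr0 eqxx.
Qed.

(** The constituents over chi_t of the restriction of chi_j to U * P are the
    products of chi_c with characters of P / U; one of them has small degree, so
    the factor from P / U is linear, and that product is again an extension of
    chi_t. *)
Lemma constt_p_section (gT : finGroupType) (G P U V J : {group gT}) (q : nat)
    (t : Iirr U) (c : Iirr J) (j : Iirr G) :
    p.-group P -> P \subset G -> (forall s : Iirr P, (deg s <= q)%N -> deg s = 1%N) ->
    U <| G -> G \subset 'I['chi_t] -> J :=: (U * P)%g -> 'Res[U] 'chi_c = 'chi_t ->
    t \in irr_constt ('Res[U] 'chi_j) -> ((deg j)`_p <= q)%N ->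
    V <| G -> U \subset V -> V \subset J ->
  exists2 m : Iirr V, (m \in irr_constt ('Res[V] 'chi_j)) && (deg m == deg t)
    & exists d : Iirr J, 'Res[V] 'chi_d = 'chi_m.
Proof.
move=> pP sPG linP nsUG IGt defJ Rc tj le_j nsVG sUV sVJ; have [sUG nUG] := andP nsUG.
have sJG : J \subset G by rewrite defJ mul_subG.
have sUJ := subset_trans sUV sVJ; have nsUJ : U <| J := normalS sUJ sJG nsUG.
have sPJ : P \subset J by rewrite defJ mulG_subr.
have nUP := subset_trans sPG nUG.
have NRj : 'Res[J] 'chi_j \is a character by rewrite cfRes_char ?irr_char.
have RJ1 : 'Res[J] 'chi_j 1%g = (deg j)%:R by rewrite cfRes1 degE.
have [d dj le_d] := small_constituent p_pr NRj RJ1 (deg_gt0 j).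
have td := constt_Res_invariant nsUG sUJ sJG IGt tj dj.
have [IJ _ codJ _] := constt_Ind_ext nsUJ Rc.
have /codomP[b def_d] : d \in codom (@mul_mod_Iirr _ J U c).
  by rewrite -codJ constt_Ind_Res.
have deg_d : deg d = (deg b * deg t)%N.
  apply/eqP; rewrite -(eqr_nat algC) natrM -!degE def_d cfIirrE //.
  by rewrite cfunE mod_IirrE // cfMod1 // -Rc cfRes1.
have defJU : (J / U)%G :=: (P / U)%g by rewrite /= defJ quotientMidl.
have pJU : p.-group (J / U)%g by rewrite /= defJU quotient_pgroup.
have b1 : deg b = 1%N.
  have [s def_s] := irr_inflate b defJU nUP; rewrite -def_s; apply: linP.
  rewrite def_s -(deg_pgroup b pJU) (leq_trans _ (leq_trans le_d le_j)) //.
  by rewrite deg_d partnM ?deg_gt0 // leq_pmulr.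
have Rd : 'Res[U] 'chi_d = 'chi_t.
  have [e def_e ->] := Res_invariant_irr nsUJ (subset_trans sJG IGt) td.
  have /eqP := def_e; rewrite deg_d b1 eqn_pmul2r ?deg_gt0 // => /eqP <-.
  by rewrite scale1r.
have /irrP[m Rm] : 'Res[V] 'chi_d \in irr V.
  apply: (@cfRes_irr_irr _ V U); first by rewrite cfRes_char ?irr_char.
  by rewrite cfResRes // Rd mem_irr.
exists m; last by exists d.
apply/andP; split.
  have NRd : 'Res[V] 'chi_d \is a character by rewrite cfRes_char ?irr_char.
  have md : m \in irr_constt ('Res[V] 'chi_d) by rewrite Rm constt_irr !inE.
  by have := constt_Res_trans NRj dj md; rewrite cfResRes.
by rewrite -(eqr_nat algC) -!degE -Rm -Rd !cfRes1.
Qed.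

(** A constituent whose stabilizer meets P in a Sylow subgroup R of the
    stabilizer is fixed by P: |P : R| is at most q, so the elements of V that
    centralize R modulo U normalize P, hence centralize P modulo U, and an
    element of P \ R normalizing R would fix chi_m. *)
Lemma constt_p'section (gT : finGroupType) (G P U V : {group gT}) (q : nat)
    (t : Iirr U) (j : Iirr G) :
    p.-Sylow(G) P ->
    (forall Q : {group gT}, p.-Sylow(G) Q -> Q :!=: P -> (q < #|P : P :&: Q|)%N) ->
    U <| G -> G \subset 'I['chi_t] ->
    t \in irr_constt ('Res[U] 'chi_j) -> ((deg j)`_p <= q)%N ->
    V <| G -> U \subset V -> p^'.-nat #|V : U| ->
  exists2 m : Iirr V, m \in irr_constt ('Res[V] 'chi_j) & P \subset 'I['chi_m].
Proof.
move=> sylP C1 nsUG IGt tj le_j nsVG sUV p'VU; have [sUG nUG] := andP nsUG.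
have [sPG pP _] := and3P sylP; have [sVG nVG] := andP nsVG.
have nsUV : U <| V := normalS sUV sVG nsUG.
have [m0 m0j] : exists m, m \in irr_constt ('Res[V] 'chi_j).
  exact/neq0_has_constt/Res_irr_neq0.
have [R0 sylR0] := Sylow_exists p 'I_G['chi_m0].
have [x Gx sRP] : exists2 x, x \in G & (R0 :^ x)%g \subset P.
  have [sR0 pR0 _] := and3P sylR0.
  have [x Gx] := Sylow_Jsub sylP (subset_trans sR0 (Inertia_sub _ _)) pR0.
  by exists x.
pose m := conjg_Iirr m0 x; pose R := (R0 :^ x)%G; pose T := ('I_G['chi_m])%G.
have defT : T :=: ('I_G['chi_m0] :^ x)%g.
  by rewrite /= /m conjg_IirrE -conjg_inertia ?(subsetP nVG) // conjIg conjGid.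
have sylR : p.-Sylow(T) R by rewrite defT pHallJ2.
have mj : m \in irr_constt ('Res[V] 'chi_j).
  rewrite irr_consttE conjg_IirrE -(cfConjg_id 'chi_j Gx).
  rewrite -(cfConjgRes _ (normal_refl G) nsVG Gx).
  by rewrite cfConjg_iso -irr_consttE.
exists m => //; apply: contraLR (IGt) => nIPm.
have sTG : T \subset G := Inertia_sub _ _.
have defR : P :&: T = R.
  apply: (sub_pHall sylR); first by apply: pgroupS pP; apply: subsetIl.
    by rewrite subsetI sRP (pHall_sub sylR).
  exact: subsetIr.
have ltRP : R \proper P.
  rewrite properEneq sRP andbT; apply: contraNneq nIPm => eqRP.
  by rewrite -eqRP (subset_trans (pHall_sub sylR)) // subsetIr.
have pR := pgroupS sRP pP.
have leP : (#|P : R| <= q)%N.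
  apply: leq_trans le_j.
  have -> : #|P : R| = (#|G : T|`_p)%N.
    apply/eqP; rewrite -(eqn_pmul2l (cardG_gt0 R)) Lagrange // (card_Hall sylP).
    by rewrite (card_Hall sylR) -partnM ?indexg_gt0 ?cardG_gt0 // Lagrange.
  rewrite dvdn_leq ?part_gt0 // partn_dvd ?deg_gt0 //.
  exact: index_inertia_dvd_deg.
have [z /setDP[/setIP[Pz nRz] R'z]] : exists z, z \in ('N_P(R) :\: R)%g.
  have := nilpotent_proper_norm (pgroup_nil pP) ltRP.
  by case/properP=> _ [z]; exists z; apply/setDP.
have IGz g : g \in G -> ('chi_t ^ g)%CF = 'chi_t.
  by move=> Gg; apply/inertiaJ/(subsetP IGt).
have Gz := subsetP sPG z Pz.
have sRG := subset_trans sRP sPG.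
have sVT : V \subset T by rewrite subsetI sVG sub_inertia.
have sRT := pHall_sub sylR.
case/negP: R'z; rewrite -defR inE Pz inE Gz inE (subsetP nVG) //=.
apply/eqP/(inertia_cent_quotient p_pr nsUV p'VU pR (R := R) (z := z) (t := t)) => //.
- exact: subset_trans nVG.
- exact: subset_trans nUG.
- exact: mem_p_elt pP Pz.
- exact: subsetP nVG z Gz.
- exact: subsetP nUG z Gz.
- exact: subset_trans IGt.
- exact: IGz.
- exact: (constt_Res_invariant nsUG sUV sVG IGt tj mj).
- exact: subset_trans sRT (subsetIr _ _).
(* R and its conjugate by y are Sylow subgroups of U * R, so y = w * u for some w in
   the normalizer of R and u in U, and C1 forces w to normalize P. *)
move=> y Vy cRy.
have Gy := subsetP sVG y Vy.
have nUR : R \subset 'N(U) by apply: subset_trans nUG.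
have sURT : U <*> R \subset T by rewrite join_subG sRT (subset_trans sUV).
have sylRU : p.-Sylow(U <*> R) R by rewrite (pHall_subl _ sURT sylR) ?joing_subr.
have sRyUR : (R :^ y)%g \subset U <*> R.
  apply/subsetP=> _ /imsetP[r Rr ->]; rewrite conjg_mulR groupM //.
    by rewrite mem_gen // inE Rr orbT.
  by rewrite mem_gen // inE -invg_comm groupV cRy.
have sylRy : p.-Sylow(U <*> R) (R :^ y).
  by rewrite pHallE sRyUR cardJg -(card_Hall sylRU) /=.
have [g URg defRy] := Sylow_trans sylRU sylRy.
have [u Uu [r Rr def_g]] : exists2 u, u \in U & exists2 r, r \in R & g = (r * u)%g.
  move: URg; rewrite /= joingC norm_joinEl // => /mulsgP[r u Rr Uu ->].
  by exists u => //; exists r.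
have {}defRy : (R :^ y = R :^ u)%g by rewrite defRy def_g conjsgM (conjGid Rr).
have Gu := subsetP sUG u Uu.
pose w := (y * u^-1)%g.
have nRw : w \in 'N(R) by rewrite inE /w conjsgM defRy conjsgK.
have Gw : w \in G by rewrite groupM ?groupV.
have nPw : w \in 'N(P).
  apply: contraLR leP => nNw; rewrite -ltnNge.
  have sylPw : p.-Sylow(G) (P :^ w) by rewrite pHallJ.
  have neq : (P :^ w)%G :!=: P.
    by apply: contraNneq nNw => /= eqP; rewrite inE eqP.
  apply: leq_trans (C1 _ sylPw neq) _; apply: dvdn_leq => //; apply: indexgS.
  by rewrite subsetI sRP /= -(normP nRw) conjSg.
have Vw : w \in V by rewrite groupM ?groupV // (subsetP sUV).
have Uwz : [~ w, z]%g \in U.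
  apply: (subsetP (p'_index_setI nsUV p'VU pP)); rewrite inE; apply/andP; split.
    by rewrite commgEr groupM // memJ_norm ?groupV.
  by rewrite commgEl groupM ?groupV // memJ_norm // (subsetP nVG).
rewrite -(mulgKV u y) -/w commMgJ groupM ?memJ_norm ?(subsetP nUG) //.
by rewrite commgEl groupM ?groupV // memJ_norm // (subsetP nUG).
Qed.

(** With V / U a p-section or a p'-section of G, let chi_m be a constituent of chi_j
    on V that is fixed by P and extends to V * P. If G fixes chi_m, it can replace
    chi_t. Otherwise chi_j is induced from the stabilizer of chi_m, a proper subgroup
    that contains P, where the same chi_t can be used. Hence the induction on the sum
    of #|G| and #|G : U|, which ends with U = G. *)
Theorem p'deg_over_invariant (gT : finGroupType) (G P U J : {group gT}) (q : nat)
    (t : Iirr U) (c : Iirr J) (j : Iirr G) :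
    (forall T : {group gT}, T \subset G -> psolv p T) -> p.-Sylow(G) P ->
    (forall Q : {group gT}, p.-Sylow(G) Q -> Q :!=: P -> (q < #|P : P :&: Q|)%N) ->
    (forall s : Iirr P, (deg s <= q)%N -> deg s = 1%N) ->
    U <| G -> G \subset 'I['chi_t] -> ~~ (p %| deg t)%N ->
    J :=: (U * P)%g -> 'Res[U] 'chi_c = 'chi_t ->
    t \in irr_constt ('Res[U] 'chi_j) -> ((deg j)`_p <= q)%N ->
  ~~ (p %| deg j)%N.
Proof.
have [n] := ubnP (#|G| + #|G : U|)%N; elim: n G U J t c j => // n IHn G U J t c j.
move=> /ltnSE-leGn solG sylP C1 linP nsUG IGt p't defJ Rc tj le_j.
have [sUG nUG] := andP nsUG; have [sPG pP _] := and3P sylP.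
have [eqUG | neqUG] := eqVneq (U : {set gT}) G.
  have [e -> dv_e] := invariant_deg_ratio nsUG IGt tj.
  by move: dv_e; rewrite eqUG indexgg dvdn1 => /eqP->; rewrite mul1n.
have ltUG : U \proper G by rewrite properEneq neqUG.
have [V [nsVG ltUV _ pfacV]] := solG G (subxx G) U G nsUG (normal_refl G) ltUG.
have [sUV [sVG nVG]] := (proper_sub ltUV, andP nsVG).
have nsUV : U <| V := normalS sUV sVG nsUG.
have nVP := subset_trans sPG nVG.
suffices [m mj [p'm IPm [K defK [d Rd]]]] : exists2 m : Iirr V,
    m \in irr_constt ('Res[V] 'chi_j) & [/\ ~~ (p %| deg m)%N, P \subset 'I['chi_m]
    & exists2 K : {group gT}, K :=: (V * P)%g
    & exists d : Iirr K, 'Res[V] 'chi_d = 'chi_m].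
- have [IGm | nIGm] := boolP (G \subset 'I['chi_m]).
    apply: (IHn G V K m d j) => //; apply: leq_trans leGn.
    rewrite ltn_add2l -(ltn_pmul2l (cardG_gt0 V)) Lagrange // -(Lagrange sUG).
    by rewrite ltn_pmul2r ?proper_card.
  pose T := ('I_G['chi_m])%G; have sTG : T \subset G := Inertia_sub _ _.
  have ltTG : T \proper G.
    rewrite properEneq sTG andbT; apply: contraNneq nIGm => eqTG.
    by rewrite -eqTG subsetIr.
  have sPT : P \subset T by rewrite subsetI sPG.
  have sylPT : p.-Sylow(T) P := pHall_subl sPT sTG sylP.
  have sVT : V \subset T by rewrite subsetI sVG sub_inertia.
  have [_ _ imInd _ _] := constt_Inertia_bijection m nsVG.
  have /imsetP[s ms def_j] : j \in Ind_Iirr G @: irr_constt ('Ind[T] 'chi_m).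
    by rewrite imInd constt_Ind_Res.
  have [irrInd _ _ _ _] := constt_Inertia_bijection m nsVG.
  have def_degj : deg j = (#|G : T| * deg s)%N.
    apply/eqP; rewrite -(eqr_nat algC) natrM -!degE def_j cfIirrE ?irrInd //.
    by rewrite cfInd1.
  have p'GT : ~~ (p %| #|G : T|)%N.
    rewrite -p'natE //; have [_ _] := and3P sylP; apply: pnat_dvd.
    exact: indexgS.
  rewrite def_degj Euclid_dvdM // negb_or p'GT /=.
  have js : s \in irr_constt ('Res[T] 'chi_j).
    rewrite irr_consttE cfdot_Res_l def_j cfIirrE ?irrInd //.
    by rewrite (irrWnorm (irrInd s ms)) oner_eq0.
  apply: (IHn T U J t c s) => //.
  - apply: leq_trans leGn; rewrite -addSn leq_add ?proper_card //.
    by rewrite dvdn_leq ?indexg_gt0 // indexSg ?(subset_trans sUV).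
  - by move=> S sST; apply: solG; apply: subset_trans sTG.
  - move=> Q sylQ; apply: C1; rewrite pHallE (subset_trans (pHall_sub sylQ)) //=.
    by rewrite (card_Hall sylQ) -(card_Hall sylPT) (card_Hall sylP).
  - exact: normalS (subset_trans sUV sVT) sTG nsUG.
  - exact: subset_trans IGt.
  - exact: (constt_Res_invariant nsUG (subset_trans sUV sVT) sTG IGt tj js).
  apply: leq_trans le_j; rewrite def_degj dvdn_leq ?part_gt0 // partn_dvd //.
    by rewrite muln_gt0 indexg_gt0 deg_gt0.
  exact: dvdn_mull.
case/orP: pfacV => [pVU | p'VU].
  have sVJ : V \subset J.
    have pVU' : p.-group (V / U)%g by rewrite /pgroup card_quotient // normal_norm.
    have sVPU : (V / U \subset P / U)%g.
      have sylPU := quotient_pHall (subset_trans sPG nUG) sylP.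
      apply: subset_trans (pcore_sub_Hall sylPU).
      by apply: pcore_max => //; apply: quotient_normal.
    by move: sVPU; rewrite quotientSK ?(subset_trans sVG nUG) // -defJ.
  have [m /andP[mj /eqP def_m] [d Rd]] :=
    constt_p_section pP sPG linP nsUG IGt defJ Rc tj le_j nsVG sUV sVJ.
  exists m => //; rewrite def_m; split=> //.
    have sJG : J \subset G by rewrite defJ mul_subG.
    have sPJ : P \subset J by rewrite defJ mulG_subr.
    have := extendible_irr_invariant (normalS sVJ sJG nsVG) Rd.
    exact: subset_trans.
  exists J; last by exists d.
  apply/eqP; rewrite eqEsubset {1}defJ mulSg // mul_subG //.
  by rewrite defJ mulG_subr.
have [m mj IPm] := constt_p'section sylP C1 nsUG IGt tj le_j nsVG sUV p'VU.
have tm := constt_Res_invariant nsUG sUV sVG IGt tj mj.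
have p'm : ~~ (p %| deg m)%N.
  have [e -> dv_e] := invariant_deg_ratio nsUV (subset_trans sVG IGt) tm.
  rewrite Euclid_dvdM // negb_or p't andbT -p'natE //; exact: pnat_dvd dv_e p'VU.
have defW : (V <*> P)%G :=: (V * P)%g by rewrite /= norm_joinEr.
exists m => //; split=> //; exists (V <*> P)%G => //.
have sWG : V <*> P \subset G by rewrite join_subG sVG.
have IWm : V <*> P \subset 'I['chi_m] by rewrite join_subG sub_inertia.
apply: (extension_over_p'section _ _ sUV p'VU pP defW defJ _ _ IWm Rc tm p'm).
- exact: normalS (subset_trans sUV (joing_subl _ _)) sWG nsUG.
- exact: normalS (joing_subl _ _) sWG nsVG.
- exact: subset_trans nUG.
exact: subset_trans IGt.
Qed.

End GroupToSylow.
(** * Degrees of G with no normal p'-subgroup *)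

Section CharacterDegrees.

Variable p : nat.
Hypothesis p_pr : prime p.

(** If the characters of P of degree at most q, the p-part of deg j, were all
    linear, then distinct Sylow p-subgroups would intersect in index more than
    q, so no character of G with p-part q could have degree divisible by p. *)
Lemma exists_small_deg_Sylow (gT : finGroupType) (G P : {group gT}) (j : Iirr G) :
    (forall T : {group gT}, T \subset G -> psolv p T) -> 'O_p^'(G)%g = 1%g ->
    p.-Sylow(G) P -> (p %| deg j)%N ->
  exists s : Iirr P, (1 < deg s <= (deg j)`_p)%N.
Proof.
move=> solG p'G1 sylP p_j; apply/existsP; apply: contraLR p_j.
rewrite negb_exists => /forallP no_s; have [sPG _ _] := and3P sylP.
have linP (s : Iirr P) : (deg s <= (deg j)`_p)%N -> deg s = 1%N.
  by have := no_s s; have := deg_gt0 s; case: (deg s) => [|[|d]] //= _ /negPf->.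
have IG0 : G \subset 'I['chi[1%G : {group gT}]_0] by rewrite inertia_irr0 norms1.
have R0 : 'Res[1%G] 'chi[P]_0 = 'chi_0 by rewrite !irr0 cfRes_cfun1 ?sub1G.
have j0 : 0 \in irr_constt ('Res[1%G] 'chi_j).
  rewrite irr_consttE cfdotE big_set1 cfRes1 irr0 cfun11 conjC1 mulr1.
  by rewrite mulf_neq0 ?irr1_neq0 ?invr_eq0 ?neq0CG.
apply: (p'deg_over_invariant p_pr solG sylP _ linP (normal1 G) IG0 _ _ R0 j0) => //.
- move=> Q sylQ; rewrite ltnNge; apply: contraNN => le_q; apply/eqP/esym.
  apply: (Sylow_eq_small_index (solG G (subxx G)) p'G1 sylP sylQ) => i le_i.
  by rewrite -deg_eq1; apply/eqP/linP/(leq_trans le_i).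
- by rewrite deg_lin ?irr0 ?cfun1_lin_char // dvdn1; case: (p) p_pr => [|[|]].
by rewrite /= mul1g.
Qed.

(** * The maximal ideal M *)

Section MaximalIdeal.

Variable M : {pred algC}.
Hypothesis maxM : maximal_ideal_over p M.

Lemma maxid_Aint x : x \in M -> x \in Aint.
Proof. by case: maxM => [[[MA _ _ _] _ _] _]; apply: MA. Qed.

Lemma maxid0 : 0 \in M.
Proof. by case: maxM => [[[]]]. Qed.

Lemma maxidD x y : x \in M -> y \in M -> x + y \in M.
Proof. by case: maxM => [[[_ _ MD _] _ _] _]; apply: MD. Qed.

Lemma maxidZ a x : a \in Aint -> x \in M -> a * x \in M.
Proof. by case: maxM => [[[_ _ _ MZ] _ _] _]; apply: MZ. Qed.

Lemma maxidN x : x \in M -> - x \in M.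
Proof. by move=> Mx; rewrite -mulN1r maxidZ // rpredN1. Qed.

Lemma maxidB x y : x \in M -> y \in M -> x - y \in M.
Proof. by move=> Mx My; rewrite maxidD ?maxidN. Qed.

Lemma maxid_sum (I : finType) (Q : pred I) (F : I -> algC) :
  (forall i, Q i -> F i \in M) -> \sum_(i | Q i) F i \in M.
Proof.
by move=> MF; elim/big_ind: _ => // [|x y]; [apply: maxid0 | apply: maxidD].
Qed.

Lemma maxid1 : 1 \notin M.
Proof. by case: maxM => [[_ M'1 _] _]; apply/negP. Qed.

Lemma maxid_p_mul a : a \in Aint -> p%:R * a \in M.
Proof. by case: maxM => _ Mp Aa; rewrite mulrC maxidZ. Qed.

(** M is prime: M + Aint * a is an ideal larger than M, so it contains 1. *)
Lemma maxid_prime a b :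
  a \in Aint -> b \in Aint -> a * b \in M -> a \notin M -> b \in M.
Proof.
move=> Aa Ab Mab M'a; case: maxM => [[_ _ max_M] _].
pose J x := exists2 m, m \in M & exists2 y, y \in Aint & x = m + y * a.
apply: contraT => M'b; case/negP: M'a; apply: (max_M J).
- split=> [x | | x y | c x Ac].
  + by case=> m Mm [y Ay ->]; apply: rpredD; [apply: maxid_Aint | apply: rpredM].
  + by exists 0; rewrite ?maxid0 //; exists 0; rewrite ?rpred0 // mul0r addr0.
  + case=> m1 Mm1 [y1 Ay1 ->] [m2 Mm2 [y2 Ay2 ->]].
    exists (m1 + m2); first exact: maxidD.
    by exists (y1 + y2); rewrite ?rpredD // mulrDl addrACA.
  case=> m Mm [y Ay ->]; exists (c * m); first exact: maxidZ.
  by exists (c * y); rewrite ?rpredM // mulrDr mulrA.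
- case=> m Mm [y Ay def1]; case/negP: M'b.
  rewrite -[b]mul1r def1 mulrDl -mulrA.
  by apply: maxidD; [rewrite mulrC maxidZ | apply: maxidZ].
- by move=> x Mx; exists x => //; exists 0; rewrite ?rpred0 // mul0r addr0.
by exists 0; rewrite ?maxid0 //; exists 1; rewrite ?rpred1 // mul1r add0r.
Qed.

Lemma maxid_exp a n : a \in Aint -> a ^+ n.+1 \in M -> a \in M.
Proof.
move=> Aa; elim: n => [|n IHn]; first by rewrite expr1.
rewrite exprS => Man; apply: contraT => M'a; case/negP: (M'a).
by apply: IHn; apply: maxid_prime Man M'a; rewrite ?rpredX.
Qed.

Lemma maxid_natE n : (n%:R \in M) = (p %| n)%N.
Proof.
apply/idP/idP => [Mn | /dvdnP[k ->]]; last first.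
  by rewrite mulnC natrM maxid_p_mul ?rpred_nat.
apply: contraLR Mn => p'n; apply: contra maxid1 => Mn.
have [u _ /dvdnP[v def_v]] := Bezoutl n (prime_gt0 p_pr).
have: (u * n)%:R \in M by rewrite natrM maxidZ ?rpred_nat.
have: (v * p)%:R \in M by rewrite mulnC natrM maxid_p_mul ?rpred_nat.
have co_pn : gcdn p n = 1%N by apply/eqP; rewrite -/(coprime p n) prime_coprime.
rewrite -def_v co_pn.
move=> Mv Mu; have := maxidB Mv Mu.
by rewrite natrD addrK.
Qed.

End MaximalIdeal.

(** * Class sums of a group with no normal p'-subgroup *)

(** Modulo p only the elements of the class that commute with N count in the sum,
    because x and its conjugates under N act in the same way on the vectors fixed
    by N. The elements that commute with N lie in N, so they fix these vectors. *)
Lemma class_sum_rfix (gT : finGroupType) (G N : {group gT}) (F : fieldType) n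
    (rG : mx_representation F G n) x :
    p \in [pchar F] -> p.-group N -> N <| G -> 'C_G(N) \subset N -> x \in G ->
  rfix_mx rG N *m (\sum_(y in x ^: G) rG y - #|x ^: G|%:R%:M) = 0.
Proof.
move=> pF pN nsNG sCN Gx; have [sNG nNG] := andP nsNG.
have sKG : x ^: G \subset G by rewrite class_subG.
set W := rfix_mx rG N; have modW : mxmodule rG W := normal_rfix_mx_module _ nsNG.
have fixW (V : 'M_n) y : (V <= W)%MS -> y \in N -> V *m rG y = V.
  by move/rfix_mxP; apply.
have actN : [acts N, on x ^: G | 'J].
  by rewrite astabsJ (subset_trans sNG) // class_norm.
have fN : {in x ^: G & N, forall y a,
    W *m rG ('J%act y a) - W = W *m rG y - W}.
- move=> y a Ky Na; have [Gy Ga] := (subsetP sKG y Ky, subsetP sNG a Na).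
  congr (_ - W); rewrite /= conjgE !repr_mxM ?groupM ?groupV // !mulmxA.
  by rewrite (fixW W) ?groupV // fixW //; apply: mxmoduleP.
have := sum_afix_ind (I := fun u => u = 0) pN actN fN.
rewrite [X in _ - X]big1 => [|y]; last first.
  rewrite afixJ => /setIP[Ky cNy]; apply/eqP; rewrite subr_eq0; apply/eqP.
  by rewrite fixW // (subsetP sCN) // inE (subsetP sKG).
rewrite subr0 mulmxBr mulmx_sumr mul_mx_scalar sumrB sumr_const scaler_nat.
apply=> // [u v -> -> | y Ky m]; first by rewrite addr0.
by rewrite mulrnA -[_ *+ p]scaler_nat (pcharf0 pF) scale0r mul0rn.
Qed.

(** A nonzero submodule contains nonzero vectors fixed by N. *)
Lemma rank_module_mul (gT : finGroupType) (G N : {group gT}) (F : fieldType) n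
    (rG : mx_representation F G n) (B D : 'M_n) :
    p \in [pchar F] -> p.-group N -> N \subset G -> mxmodule rG B -> B != 0 ->
    rfix_mx rG N *m D = 0 ->
  (\rank (B *m D) < \rank B)%N.
Proof.
move=> pF pN sNG modB nzB WD0.
rewrite -(mxrank_mul_ker B D) -[X in (X < _)%N]addn0 ltn_add2l lt0n mxrank_eq0.
have := rfix_pgroup_pchar pF (submod_repr modB) _ pN sNG.
rewrite lt0n mxrank_eq0 => /(_ nzB).
apply: contraNneq => cap0; rewrite -submx0 (rfix_submod modB sNG).
have: (B :&: rfix_mx rG N <= B :&: kermx D)%MS.
  by rewrite capmxS //; apply/sub_kermxP.
by rewrite cap0 submx0 => /eqP->; rewrite linear0 sub0mx.
Qed.

(** The images of the powers are submodules, whose ranks decrease by the two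
    previous lemmas. *)
Lemma class_sum_nilpotent (gT : finGroupType) (G N : {group gT}) (F : fieldType)
    (k : 'I_#|classes G|) :
    p \in [pchar F] -> p.-group N -> N <| G -> 'C_G(N) \subset N ->
  iter #|G| (mulmxr (gring_class_sum F k - #|enum_val k|%:R%:M)) 1%:M = 0.
Proof.
move=> pF pN nsNG sCN; set D := (_ - _); pose aG := regular_repr F G.
have Dk : rfix_mx aG N *m D = 0.
  have [x Gx def_k] := imsetP (enum_valP k).
  by rewrite /D /gring_class_sum /gset_mx def_k; apply: class_sum_rfix.
pose B r := iter r (mulmxr D) (1%:M : 'M_#|G|).
have modB r : mxmodule aG (B r).
  apply/mxmoduleP=> x Gx; elim: r => [|r IHr] /=; first exact: submx1.
  have /center_mxP[_ cD] := gring_class_sum_central F k.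
  have -> : B r *m D *m aG x = B r *m aG x *m D.
    rewrite -!mulmxA; congr (_ *m _); rewrite mulmxBr mulmxBl cD ?envelop_mx_id //.
    by rewrite mul_mx_scalar mul_scalar_mx.
  exact: submxMr.
have rB r : (\rank (B r) <= #|G| - r)%N.
  elim: r => [|r IHr]; first by rewrite subn0 rank_leq_row.
  have [B0 | nzB] := eqVneq (B r) 0; first by rewrite /= B0 mul0mx mxrank0.
  have lt_r := rank_module_mul pF pN (normal_sub nsNG) (modB r) nzB Dk.
  rewrite subnS -ltnS (leq_trans lt_r) //.
  by rewrite (leq_trans IHr) // leqSpred.
by apply/eqP; rewrite -mxrank_eq0 -leqn0; have := rB #|G|; rewrite subnn.
Qed.

Lemma class_sum1 (gT : finGroupType) (G : {group gT}) (F : fieldType)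
    (k : 'I_#|classes G|) :
  1%g \in enum_val k -> gring_class_sum F k = 1%:M :> 'M_#|G|.
Proof.
have /imsetP[x Gx def_k] := enum_valP k; rewrite /gring_class_sum /gset_mx def_k.
by move/class_eqP => <-; rewrite class1G big_set1 repr_mx1.
Qed.

(** The class sums have integer structure constants, so the powers of
    'K_k - #|K| are the same integer combinations of class sums over all fields;
    this transfers the nilpotency over 'F_p to a congruence in characteristic 0. *)
Lemma class_sum_power (gT : finGroupType) (G : {group gT}) (k : 'I_#|classes G|) r :
  exists c : 'I_#|classes G| -> int, forall F : fieldType,
    iter r (mulmxr (gring_class_sum F k - #|enum_val k|%:R%:M)) 1%:M
      = \sum_j (c j)%:~R *: gring_class_sum F j :> 'M_#|G|.
Proof.
elim: r => [|r [c def_c]].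
  pose k1 := enum_rank_in (classes1 G) (1%g ^: G).
  exists (fun j => (j == k1)%:Z) => F /=; rewrite (bigD1 k1) //= eqxx scale1r.
  rewrite big1 ?addr0 => [|j /negPf->]; last by rewrite scale0r.
  by rewrite class_sum1 // enum_rankK_in ?mem_classes ?class_refl.
exists (fun j => \sum_i c i * (gring_classM_coef i k j)%:Z - c j * #|enum_val k|%:Z).
move=> F; rewrite iterS def_c /= mulmxBr mul_mx_scalar.
have -> : (\sum_i (c i)%:~R *: gring_class_sum F i) *m gring_class_sum F k
        = \sum_i \sum_j ((c i)%:~R * (gring_classM_coef i k j)%:R) *: gring_class_sum F j.
  rewrite mulmx_suml; apply: eq_bigr => i _.
  rewrite -scalemxAl gring_classM_expansion scaler_sumr.
  by apply: eq_bigr => j _; rewrite scalerA.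
rewrite exchange_big scaler_sumr -sumrB; apply: eq_bigr => j _ /=.
rewrite rmorphB rmorph_sum /= scalerBl scaler_suml scalerA rmorphM mulrC.
by congr (_ - _); apply: eq_bigr => i _; rewrite rmorphM.
Qed.

(** Over 'F_p some power of 'K_k - #|K| vanishes, so in characteristic 0 it is an
    integer combination of class sums with coefficients divisible by p, which
    'omega_i maps into the prime ideal M. *)
Lemma mode_class_sum_mod (gT : finGroupType) (G : {group gT}) (M : {pred algC})
    (i : Iirr G) (k : 'I_#|classes G|) :
    maximal_ideal_over p M -> psolv p G -> 'O_p^'(G)%g = 1%g ->
  'omega_i['K_k] - #|enum_val k|%:R \in M.
Proof.
move=> maxM solG p'G1; have pFp := pchar_Fp p_pr.
have sCN := cent_pcore_sub solG p'G1.
have [c def_c] := class_sum_power k #|G|.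
have p_c j : exists b : int, c j = p%:Z * b.
  have := class_sum_nilpotent k pFp (pcore_pgroup p G) (pcore_normal p G) sCN.
  rewrite def_c => sum0.
  have /row_freeP[B mulB] := classg_base_free [the fieldType of 'F_p] G.
  have: (\row_j (c j)%:~R) *m classg_base 'F_p G = 0.
    rewrite mulmx_sum_row -[RHS](linear0 mxvec) -sum0 linear_sum.
    by apply: eq_bigr => j1 _; rewrite linearZ rowK mxE.
  move/(congr1 (mulmx^~ B)); rewrite -mulmxA mulB mulmx1 mul0mx => /rowP/(_ j).
  rewrite !mxE => /eqP; rewrite -(dvdz_pcharf pFp) => /dvdzP[b ->].
  by exists b; rewrite mulrC.
have K_Z (A : 'I_#|classes G| -> algC) :
    (\sum_j A j *: 'K_j \in 'Z(group_ring algCfield G))%MS.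
  rewrite linear_sum summx_sub // => j _; rewrite linearZ scalemx_sub //.
  exact: gring_class_sum_central.
have omega1 : 'omega_i[1%:M] = 1.
  pose k1 := enum_rank_in (classes1 G) (1%g ^: G).
  have k1_1 : 1%g \in enum_val k1 by rewrite enum_rankK_in ?mem_classes ?class_refl.
  rewrite -(class_sum1 _ k1_1) (gring_mode_class_sum_eq _ k1_1) class1G cards1.
  by rewrite mul1r divff ?irr1_neq0.
set w := _ - _.
have omega_pow r : 'omega_i[iter r (mulmxr ('K_k - #|enum_val k|%:R%:M)) 1%:M] = w ^+ r.
  elim: r => [|r IHr]; first exact: omega1.
  rewrite iterS exprSr -IHr /=; have [d ->] := class_sum_power k r.
  rewrite gring_irr_modeM //; last first.
    have [d1] := class_sum_power k 1; move/(_ [the fieldType of algCfield]).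
    by rewrite /= mul1mx => ->.
  by congr (_ * _); rewrite raddfB /= -scalemx1 xcfunZr omega1 mulr1.
apply: (maxid_exp maxM (n := #|G|.-1)).
  by rewrite rpredB ?rpred_nat ?Aint_gring_mode_class_sum.
rewrite prednK ?cardG_gt0 // -omega_pow def_c raddf_sum.
apply: maxid_sum => // j _; rewrite /=; have [b ->] := p_c j.
rewrite xcfunZr rmorphM -mulrA maxid_p_mul //.
by rewrite rpredM ?Aint_gring_mode_class_sum // Aint_int ?intr_int.
Qed.

(** * The principal block *)

Section PrincipalBlock.

Variables (gT : finGroupType) (G : {group gT}) (M : {pred algC}).
Hypothesis maxM : maximal_ideal_over p M.

Lemma mode_class_sumE (i : Iirr G) (k : 'I_#|classes G|) :
  'omega_i['K_k] * 'chi_i 1%g = \sum_(x in enum_val k) 'chi_i x.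
Proof.
have /imsetP[g Gg def_k] := enum_valP k.
have kg : g \in enum_val k by rewrite def_k class_refl.
rewrite (gring_mode_class_sum_eq _ kg) divfK ?irr1_neq0 // def_k.
rewrite (eq_bigr (fun _ => 'chi_i g)) ?sumr_const ?mulr_natl // => _ /imsetP[y Gy ->].
by rewrite cfunJ.
Qed.

Lemma mode_class_sum0 (k : 'I_#|classes G|) :
  'omega_(0 : Iirr G)['K_k] = #|enum_val k|%:R.
Proof.
have := mode_class_sumE 0 k; rewrite irr0 cfun11 mulr1 => ->.
have /imsetP[g Gg ->] := enum_valP k.
rewrite (eq_bigr (fun _ => 1)) ?sumr_const // => x /(subsetP (class_subG Gg (subxx G))).
by rewrite cfun1E => ->.
Qed.

(** A class sum not killed mod M by a character of the principal block is not
    killed by the trivial character, which maps it to the size of the class. *)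
Lemma defect_group_principal_Sylow (D : {group gT}) :
  defect_group p M (principal_block M G) D -> p.-Sylow(G) D.
Proof.
case=> k [[[i B_i M'i] _] [x kx sylD]].
have p'k : ~~ (p %| #|enum_val k|)%N.
  rewrite -(maxid_natE maxM) -mode_class_sum0; apply: contra M'i => M0.
  move: B_i; rewrite inE => /forallP/(_ k) Bi.
  by rewrite -['omega_i[_]](subKr 'omega_(0 : Iirr G)['K_k]) (maxidB maxM).
have /imsetP[g Gg def_k] := enum_valP k.
move: p'k; rewrite def_k in kx *; rewrite -(class_eqP kx) -index_cent1 => p'i.
have [sDC pD p'CD] := and3P sylD; have sCG : 'C_G[x] \subset G by apply: subsetIl.
rewrite /pHall (subset_trans sDC) // pD /=.
by rewrite -(Lagrange_index sCG sDC) pnatM p'CD p'natE // p'i.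
Qed.

Lemma sum_normal_classes (X : {group gT}) (f : gT -> algC) :
    X <| G ->
  \sum_(x in X) f x = \sum_(k < #|classes G| | enum_val k \subset X)
                        \sum_(x in enum_val k) f x.
Proof.
move=> nsXG; have [sXG nXG] := andP nsXG.
pose h x := enum_rank_in (classes1 G) (x ^: G).
have hK x : x \in G -> enum_val (h x) = x ^: G.
  by move=> Gx; rewrite /h enum_rankK_in ?mem_classes.
rewrite (partition_big h (fun k => enum_val k \subset X)) => [|x Xx] /=.
  apply: eq_bigr => k skX; apply: eq_bigl => x.
  have /imsetP[g Gg def_k] := enum_valP k.
  apply/andP/idP => [[Xx /eqP <-] | kx].
    by rewrite hK ?class_refl ?(subsetP sXG).
  split; first exact: subsetP kx.
  apply/eqP/enum_val_inj; rewrite hK ?(subsetP sXG) ?(subsetP skX) // def_k.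
  by apply/class_eqP; rewrite -def_k.
by rewrite hK ?(subsetP sXG) // class_sub_norm.
Qed.

(** Over the classes contained in X, the central character of a character in the
    principal block has a sum congruent to #|X|, which is not in M. So the
    restriction of the character to X contains the trivial character. *)
Lemma principal_block_ker (X : {group gT}) (i : Iirr G) :
  X <| G -> p^'.-group X -> i \in principal_block M G -> X \subset cfker 'chi_i.
Proof.
move=> nsXG p'X; rewrite inE => /forallP B_i; have [sXG _] := andP nsXG.
apply: constt0_Res_cfker => //; apply: contraLR p'X => /negPn.
rewrite /pgroup p'natE // negbK -(maxid_natE maxM).
pose S := \sum_(k < #|classes G| | enum_val k \subset X) 'omega_i['K_k].
have S0 : S * 'chi_i 1%g = #|X|%:R * '['Res[X] 'chi_i, 'chi_0].
  rewrite mulr_suml cfdotE mulVKf ?neq0CG // (eq_bigr _ (fun k _ => mode_class_sumE i k)).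
  rewrite -sum_normal_classes //; apply: eq_bigr => x Xx.
  by rewrite irr0 cfun1E Xx conjC1 mulr1 cfResE.
move=> /eqP dot0; move: S0; rewrite dot0 mulr0 => /eqP.
rewrite mulf_eq0 (negPf (irr1_neq0 i)) orbF => /eqP S0.
have <- : \sum_(k < #|classes G| | enum_val k \subset X)
            ('omega_(0 : Iirr G)['K_k] - 'omega_i['K_k]) = #|X|%:R.
  rewrite sumrB -/S S0 subr0 (eq_bigr _ (fun k _ => mode_class_sum0 k)).
  rewrite -[in RHS]sum1_card natr_sum sum_normal_classes //; apply: eq_bigr => k _.
  by rewrite -sum1_card natr_sum.
by apply: (maxid_sum maxM) => k _; apply: B_i.
Qed.

Lemma card_class_quotient (X : {group gT}) x :
  X <| G -> x \in G -> (#|coset X x ^: (G / X)| %| #|x ^: G|)%N.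
Proof.
move=> nsXG Gx; have [_ nXG] := andP nsXG.
rewrite -!index_cent1; apply: dvdn_trans (index_quotient _).
  apply: indexgS; rewrite subsetI quotientS ?subsetIl //=.
  by rewrite quotient_cent1s // ?subsetIr.
by rewrite subIset ?nXG.
Qed.

(** Both sides of the congruence that defines the block are multiples, by the same
    integer, of their analogues for the quotient of G by its p'-core, where
    mode_class_sum_mod applies. *)
Lemma mem_principal_block (i : Iirr G) :
    psolv p G -> (i \in principal_block M G) = ('O_p^'(G)%g \subset cfker 'chi_i).
Proof.
move=> solG; have nsXG := pcore_normal p^' G; set X := ('O_p^'(G))%G in nsXG *.
apply/idP/idP => [|kerX].
  by apply: principal_block_ker => //; apply: pcore_pgroup.
have [_ nXG] := andP nsXG.
rewrite inE; apply/forallP=> k; rewrite mode_class_sum0 -opprB (maxidN maxM) //.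
have /imsetP[x Gx def_k] := enum_valP k.
have kx : x \in enum_val k by rewrite def_k class_refl.
pose j := quo_Iirr X i.
have Hx : coset X x \in (G / X)%g by apply: mem_quotient.
pose k1 := enum_rank_in (classes1 (G / X)) (coset X x ^: (G / X)).
have def_k1 : enum_val k1 = coset X x ^: (G / X).
  by rewrite enum_rankK_in ?mem_classes.
have k1x : coset X x \in enum_val k1 by rewrite def_k1 class_refl.
have [m def_m] := dvdnP (card_class_quotient nsXG Gx).
have p'H : ('O_p^'(G / X) = 1)%g by apply: trivg_pcore_quotient.
have := mode_class_sum_mod j k1 maxM (psolv_quotient nsXG solG) p'H.
rewrite (gring_mode_class_sum_eq _ k1x) (gring_mode_class_sum_eq _ kx) def_k def_k1.
rewrite def_m quo_IirrE // cfQuoE // cfQuo1 natrM -!mulrA -mulrBr.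
by apply: maxidZ; rewrite ?rpred_nat.
Qed.

End PrincipalBlock.

(** * Minimal heights *)

Lemma exists_small_deg_Sylow_over_p'core (gT : finGroupType) (G P : {group gT})
    (i : Iirr G) :
    psolvable p G -> p.-Sylow(G) P -> 'O_p^'(G)%g \subset cfker 'chi_i ->
    (p %| deg i)%N ->
  exists s : Iirr P, (1 < deg s <= (deg i)`_p)%N.
Proof.
move=> solG sylP kerX p_i; have nsXG := pcore_normal p^' G.
set X := ('O_p^'(G))%G in nsXG kerX *; have [_ nXG] := andP nsXG.
have def_i : deg (quo_Iirr X i) = deg i by rewrite -(deg_mod _ nsXG) quo_IirrK.
have solT (T : {group coset_of X}) : T \subset (G / X)%g -> psolv p T.
  move=> sTG; have [S defT sXS sSG] := inv_quotientS nsXG sTG.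
  have -> : T = (S / X)%G by apply: group_inj.
  by apply: psolv_quotient; [apply: normalS nsXG | apply: psolvable_psolv sSG].
have sPX := quotient_pHall (subset_trans (pHall_sub sylP) nXG) sylP.
have p'GX := trivg_pcore_quotient p^' G.
have [|s s_lt] := exists_small_deg_Sylow solT p'GX sPX (j := quo_Iirr X i).
  by rewrite def_i.
have [s1 def_s] := irr_inflate s (erefl _) (subset_trans (pHall_sub sylP) nXG).
by exists s1; rewrite def_s -def_i.
Qed.

Lemma exists_small_deg_over_p'core (gT : finGroupType) (G P : {group gT}) (s : Iirr P) :
    psolv p G -> p.-Sylow(G) P -> (1 < deg s)%N ->
  exists j : Iirr G, [/\ 'O_p^'(G)%g \subset cfker 'chi_j, (p %| deg j)%N
                       & ((deg j)`_p <= deg s)%N].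
Proof.
move=> solG sylP s_gt1; have nsXG := pcore_normal p^' G.
set X := ('O_p^'(G))%G in nsXG *; have [_ nXG] := andP nsXG.
have [sPG pP _] := and3P sylP; have nXP := subset_trans sPG nXG.
have tiXP : X :&: P = 1%g.
  apply: coprime_TIg; rewrite coprime_sym (pnat_coprime pP) //.
  exact: (pcore_pgroup p^' G).
have [t def_t] := irr_quotient_isom s nXP tiXP.
have sPX := quotient_pHall nXP sylP.
have [|j p_j le_j] := exists_small_deg p_pr (psolv_quotient nsXG solG) sPX (s := t).
  by rewrite def_t.
exists (mod_Iirr j); rewrite deg_mod // -def_t; split=> //.
by rewrite mod_IirrE // cfker_mod.
Qed.

(** The condition on D says that the defect is maximal, so that the height of chi_i
    is the exponent of p in its degree. *)
Lemma mh_min (gT : finGroupType) (G D : {group gT}) (B : {set Iirr G}) (i : Iirr G) :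
    logn p #|D| = logn p #|G| -> i \in B -> (p %| deg i)%N ->
  exists2 j, [/\ j \in B, (p %| deg j)%N & mh p B D = logn p (deg j)]
           & forall k, k \in B -> (p %| deg k)%N -> (logn p (deg j) <= logn p (deg k))%N.
Proof.
move=> eqDG Bi p_i.
have hE (k : Iirr G) : height p D k = logn p (deg k).
  by rewrite /height -/(deg k) eqDG addnK.
have hp (k : Iirr G) : (0 < height p D k)%N = (p %| deg k)%N.
  by rewrite hE logn_gt0 mem_primes p_pr deg_gt0.
rewrite /mh; case: pickP => [i0 Bi0 | /(_ i)]; last by rewrite Bi hp p_i.
case: arg_minnP => // j /andP[Bj]; rewrite hp => p_j min_j.
exists j; first by rewrite hE.
by move=> k Bk p_k; rewrite -!hE min_j // Bk hp.
Qed.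

End CharacterDegrees.

Theorem theoremA (p : nat) (gT : finGroupType) (G D : {group gT})
    (M : {pred algC}) (p_pr : prime p) (maxM : maximal_ideal_over p M)
    (psolG : psolvable p G)
    (defD : defect_group p M (principal_block M G) D)
    (nabD : ~~ abelian D) :
  mh p (principal_block M G) D = mh_pgroup p D.
Proof.
have sylD := defect_group_principal_Sylow p_pr maxM defD.
have solG : psolv p G := psolvable_psolv psolG (subxx G).
have [sDG pD _] := and3P sylD.
have [s s_gt1] : exists s : Iirr D, (1 < deg s)%N.
  apply/existsP; apply: contraR nabD; rewrite negb_exists => /forallP lin.
  apply/char_abelianP=> i; rewrite -deg_eq1 eqn_leq deg_gt0 andbT leqNgt.
  exact: lin.
have p_gt1 (t : Iirr D) : (p %| deg t)%N = (1 < deg t)%N.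
  have /p_natP[e ->] := natdeg_pgroup t pD.
  case: e => [|e]; first by rewrite dvdn1 ltnn (gtn_eqF (prime_gt1 p_pr)).
  by rewrite expnS dvdn_mulr // -expnS -(exp1n e.+1) ltn_exp2r // prime_gt1.
have logE (n q : nat) : (n`_p <= q`_p)%N -> (logn p n <= logn p q)%N.
  by rewrite !p_part leq_exp2l ?prime_gt1.
have p_s : (p %| deg s)%N by rewrite p_gt1.
rewrite /mh_pgroup; have [t [_ p_t ->] min_t] := mh_min p_pr (erefl _) (in_setT s) p_s.
have t_gt1 : (1 < deg t)%N by rewrite -p_gt1.
have [j [kerj p_j le_j]] := exists_small_deg_over_p'core p_pr solG sylD t_gt1.
rewrite -(mem_principal_block p_pr maxM) // in kerj.
have eqDG : logn p #|D| = logn p #|G|.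
  by rewrite (card_Hall sylD) p_part pfactorK.
have [i [Bi p_i ->] min_i] := mh_min p_pr eqDG kerj p_j.
have [|s1 /andP[s1_gt1 le_s1]] :=
  exists_small_deg_Sylow_over_p'core p_pr psolG sylD _ p_i.
  by rewrite -(mem_principal_block p_pr maxM).
apply/eqP; rewrite eqn_leq; apply/andP; split.
  apply: leq_trans (min_i j kerj p_j) _; apply: logE.
  by rewrite (deg_pgroup t pD).
apply: leq_trans (min_t s1 (in_setT _) _) _; first by rewrite p_gt1.
by apply: logE; rewrite (deg_pgroup s1 pD).
Qed.
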